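(* Let $\dim(\mathcal{X})<\infty$. Suppose $\mathcal{T}=(T_1,\ldots,T_d),\ \mathcal{S}=(S_1,\ldots,S_d)\in \mathcal{Z}$ and $\mathcal{T}\notin \mathbb{F}^d\mathcal{S}$. Then the following are equivalent. (i) $w_p(\mathcal{T}+\lambda\mathcal{S})\geq w_p(\mathcal{T})$ for all $\lambda\in\mathbb{F}^d$. (ii) There exist $n\in\mathbb{N}$ and $t_j>0$, $x_j\in E_{\mathcal{X}}$, $x_j^*\in E_{\mathcal{X}^*}$ for $1\leq j\leq n$, such that $t_1+\ldots+t_n=1$, $(x_j,x_j^* )\in M_{w_p(\mathcal{T})}$ for each $j$, and $$\sum_{j=1}^nt_j\,\overline{x_j^*(T_ix_j)}\,|x_j^*(T_ix_j)|^{p-2}\,x_j^*(S_ix_j)=0\quad\text{for all } 1\leq i\leq d.$$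
   Context: $\mathcal{X}$ is a nonzero Banach space over $\mathbb{F}$ ($\mathbb{R}$ or $\mathbb{C}$) with dual $\mathcal{X}^*$. For a normed space $\mathcal{Y}$, $S_{\mathcal{Y}}$ is its unit sphere and $E_{\mathcal{Y}}$ the set of extreme points of its closed unit ball. $\mathcal{L}(\mathcal{X})$ is the space of bounded linear operators on $\mathcal{X}$; $\Pi=\{(x,x^* ): x\in S_{\mathcal{X}},\ x^*\in S_{\mathcal{X}^*},\ x^*(x)=1\}$. Standing assumption: the numerical radius $w(T)=\sup\{|x^*(Tx)|:(x,x^* )\in\Pi\}$ is a norm on $\mathcal{L}(\mathcal{X})$ (automatic if $\mathbb{F}=\mathbb{C}$). Fix an integer $d\ge 1$ and $1<p<\infty$. The joint numerical radius of $\mathcal{T}=(T_1,\ldots,T_d)\in\mathcal{L}(\mathcal{X})^d$ is $w_p(\mathcal{T})=\sup\{(\sum_{i=1}^d|x^*(T_ix)|^p)^{1/p}:(x,x^* )\in\Pi\}$, and $\mathcal{Z}=(\mathcal{L}(\mathcal{X})^d,w_p(\cdot))$. $M_{w_p(\mathcal{T})}=\{(x,x^* )\in\Pi:(\sum_{i=1}^d|x^*(T_ix)|^p)^{1/p}=w_p(\mathcal{T})\}$. For $\lambda=(\lambda_1,\ldots,\lambda_d)\in\mathbb{F}^d$, $\lambda\mathcal{S}=(\lambda_1S_1,\ldots,\lambda_dS_d)$, and $\mathbb{F}^d\mathcal{S}=\{\lambda\mathcal{S}:\lambda\in\mathbb{F}^d\}$. Convention: $\overline{a}|a|^{p-2}$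 means $0$ when $a=0$. *)

(* Defs.v *)
From mathcomp Require Import all_boot all_order all_algebra.
From mathcomp Require Import complex.
From mathcomp Require Import boolp classical_sets functions reals.
From mathcomp Require Import topology normedtype exp.

Set Implicit Arguments.
Unset Strict Implicit.
Unset Printing Implicit Defensive.

Import Order.TTheory GRing.Theory Num.Theory.
Import numFieldNormedType.Exports.

Local Open Scope classical_set_scope.
Local Open Scope ring_scope.

Variant scalar_kind := RealScalars | ComplexScalars.

Definition scalar_field (R : realType) (k : scalar_kind) : numFieldType :=
  match k with
  | RealScalars => R
  | ComplexScalars => R[i]
  end.

Definition scalar_re (R : realType) (k : scalar_kind) : scalar_field R k -> R :=
  match k with
  | RealScalars => fun a => a
  | ComplexScalars => fun a : R[i] => complex.Re a
  end.

Definition scalar_conj (R : realType) (k : scalar_kind) :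
    scalar_field R k -> scalar_field R k :=
  match k with
  | RealScalars => fun a => a
  | ComplexScalars => fun a : R[i] => conjc a
  end.

Definition scalar_of_real (R : realType) (k : scalar_kind) :
    R -> scalar_field R k :=
  match k with
  | RealScalars => fun r => r
  | ComplexScalars => fun r => (r +i* 0)%C
  end.

(* The library norm on [R[i]] takes its values in [R[i]]; [scalar_abs] is the
   modulus as an element of [R]. *)
Definition scalar_abs (R : realType) (k : scalar_kind)
    (a : scalar_field R k) : R := scalar_re `|a|.

Definition bounded_linear (K : numFieldType) (V W : normedModType K)
    (f : V -> W) : Prop :=
  linear f /\ exists M : K, forall x, `|f x| <= M * `|x|.

(* [0 < t < 1] forces [t] to be real, also in the partial order of [R[i]]. *)
Definition extreme_points (K : numFieldType) (V : lmodType K) (A : set V) :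
    set V :=
  [set x | A x /\ forall (y z : V) (t : K), A y -> A z -> 0 < t < 1 ->
     x = t *: y + (1 - t) *: z -> y = x /\ z = x].

Definition finite_dim (K : numFieldType) (V : lmodType K) : Prop :=
  exists (n : nat) (e : 'I_n -> V), forall x : V,
  exists c : 'I_n -> K, x = \sum_(i < n) c i *: e i.

Section NumericalRadius.
Variables (R : realType) (k : scalar_kind).
Local Notation F := (scalar_field R k).
Variable X : completeNormedModType F.

(* Operators and functionals are functions satisfying [bounded_linear], with the
   pointwise vector space structure of the library. *)

Definition unit_sphere : set X := [set x | `|x| = 1].

Definition unit_ball : set X := [set x | `|x| <= 1].

(* The supremum is finite because it is only taken for bounded [f]. *)
Definition dual_norm (f : X -> F^o) : R :=
  sup [set scalar_abs (f x) | x in unit_ball].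

Definition dual_sphere : set (X -> F^o) :=
  [set f | bounded_linear f /\ dual_norm f = 1].

Definition dual_ball : set (X -> F^o) :=
  [set f | bounded_linear f /\ dual_norm f <= 1].

Definition state_pairs : set (X * (X -> F^o)) :=
  [set xf | [/\ unit_sphere xf.1, dual_sphere xf.2 & xf.2 xf.1 = 1]].

Definition num_radius (T : X -> X) : R :=
  sup [set scalar_abs (xf.2 (T xf.1)) | xf in state_pairs].

Definition num_radius_is_norm : Prop :=
  [/\ forall T : X -> X, bounded_linear T -> 0 <= num_radius T,
      forall T : X -> X, bounded_linear T -> num_radius T = 0 -> T = 0,
      forall (a : F) (T : X -> X), bounded_linear T ->
        num_radius (a *: T) = scalar_abs a * num_radius T
    & forall T S : X -> X, bounded_linear T -> bounded_linear S ->
        num_radius (T + S) <= num_radius T + num_radius S].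

Definition joint_value (p : R) (d : nat) (T : 'I_d -> X -> X)
    (xf : X * (X -> F^o)) : R :=
  (\sum_(i < d) scalar_abs (xf.2 (T i xf.1)) `^ p) `^ p^-1.

Definition joint_num_radius (p : R) (d : nat) (T : 'I_d -> X -> X) : R :=
  sup [set joint_value p T xf | xf in state_pairs].

Definition joint_attain (p : R) (d : nat) (T : 'I_d -> X -> X) :
    set (X * (X -> F^o)) :=
  [set xf | state_pairs xf /\ joint_value p T xf = joint_num_radius p T].

Definition tuple_scale (d : nat) (lam : 'I_d -> F) (S : 'I_d -> X -> X) :
    'I_d -> X -> X :=
  fun i => lam i *: S i.

End NumericalRadius.

(* At [a = 0] this is [0] for every [p], since the conjugate factor vanishes. *)
Definition conj_pow (R : realType) (k : scalar_kind) (p : R)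
    (a : scalar_field R k) : scalar_field R k :=
  scalar_conj a * scalar_of_real k (scalar_abs a `^ (p - 2)).

(* Main.v *)
Require Import Defs.
From mathcomp Require Import all_boot all_order all_algebra.
From mathcomp Require Import complex.
From mathcomp Require Import boolp classical_sets functions reals.
From mathcomp Require Import topology normedtype exp.
From mathcomp Require Import sequences derive ring lra.

Set Implicit Arguments.
Unset Strict Implicit.
Unset Printing Implicit Defensive.

Import Order.TTheory GRing.Theory Num.Theory.
Import numFieldNormedType.Exports.

Local Open Scope classical_set_scope.
Local Open Scope ring_scope.

(** Write [a i = f (T i x)] and [b i = f (S i x)] for a norming pair [(x, f)].
    The function [a |-> \sum_i abs (a i) `^ p] is convex, and
    [conj_pow p (a i)] is, up to the factor [p], its derivative: its graph lies
    above its tangents ([tangent_le]), and strictly so off the point of contact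
    ([tangent_lt]).

    Balance implies minimality by averaging: at each pair [(x j, f j)] the
    tangent inequality bounds the power at [T + lam S] from below, and the
    weighted sum of the first-order terms vanishes ([radius_ge_of_balance]).

    For the converse, the norming pairs form a compact set, in coordinates, as
    [X] is finite-dimensional ([compact_state_pairs]). If the radius is minimal
    at [T], then for every direction [lam] some attaining pair has a nonnegative
    derivative [\sum_i re (conj_pow p (a i) * (lam i * b i))]: pairs attaining
    the radius of [T + s lam S] for small [s > 0] accumulate at one
    ([exists_nonneg_derivative]). So no direction makes this derivative negative
    at all attaining pairs, which are a compact set, and a separation theorem
    ([separation_or_balance]) puts [0] in the convex hull of the vectors
    [(conj_pow p (a i) * b i)_i] of the attaining pairs.

    It remains to make [x] and [f] extreme. By Minkowski's theorem ([minkowski])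
    [x] is a convex combination of extreme points [e] of the unit ball, and
    [f x = 1] forces [f e = 1]. As the radius is attained at [(x, f)] and the
    [p]-norm is strictly convex ([sum_powR_rigid]), the values [f (T i e)] all
    equal [f (T i x)]. The vector of the pair [(x, f)], linear in [x] once its
    weights are fixed, is thus a combination of the vectors of the pairs
    [(e, f)], which attain as well; the same argument then replaces [f] by
    extreme points of the dual ball ([attaining_values_extreme]). *)

(** * Convex combinations *)

(** Convexity, with weights in the open interval so that combinations obtained
    by repeated mixing have positive weights. *)
Definition mixture_closed (R : realType) (V : lmodType R) (Q : set V) : Prop :=
  forall (x y : V) (t : R), Q x -> Q y -> 0 < t < 1 ->
    Q (t *: x + (1 - t) *: y).

(** Indexing by [W] keeps track of the points [w j] and not only of their images
    [h (w j)]. *)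
Definition combinations (R : realType) (V : lmodType R) (W : Type)
    (P : set W) (h : W -> V) : set V :=
  [set z | exists (n : nat) (t : 'I_n -> R) (w : 'I_n -> W),
    [/\ forall j, 0 < t j, \sum_(j < n) t j = 1, forall j, P (w j)
      & z = \sum_(j < n) t j *: h (w j)]].

Section Mixtures.
Variables (R : realType) (V : lmodType R).

Lemma mixture_closed_sum (Q : set V) (n : nat) (t : 'I_n -> R)
    (a : 'I_n -> V) :
  mixture_closed Q -> (forall j, 0 <= t j) -> \sum_(j < n) t j = 1 ->
  (forall j, Q (a j)) -> Q (\sum_(j < n) t j *: a j).
Proof.
move=> Qmix; elim: n t a => [|n IH] t a t_ge0 t1 Qa.
  by move/eqP: t1; rewrite big_ord0 eq_sym oner_eq0.
have rest_ge0 : 0 <= \sum_(j < n) t (lift ord0 j) by rewrite sumr_ge0.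
rewrite !big_ord_recl in t1 *.
set s := \sum_(j < n) _ in t1 rest_ge0.
have [t00|t0_neq0] := eqVneq (t ord0) 0.
  rewrite t00 scale0r add0r; apply: IH => //.
  by rewrite -/s -t1 t00 add0r.
have [s0|s_neq0] := eqVneq s 0.
  have tl0 j : t (lift ord0 j) = 0.
    by move/eqP: s0; rewrite psumr_eq0// => /allP/(_ j); rewrite mem_index_enum => /(_ isT)/eqP.
  rewrite big1 ?addr0 => [|j _]; last by rewrite tl0 scale0r.
  by move: t1; rewrite s0 addr0 => ->; rewrite scale1r.
have s_gt0 : 0 < s by rewrite lt_def s_neq0.
have t0_gt0 : 0 < t ord0 by rewrite lt_def t0_neq0 t_ge0.
have -> : \sum_(j < n) t (lift ord0 j) *: a (lift ord0 j) =
    (1 - t ord0) *: \sum_(j < n) (t (lift ord0 j) / s) *: a (lift ord0 j).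
  rewrite scaler_sumr; apply: eq_bigr => j _; rewrite scalerA.
  have -> : 1 - t ord0 = s by rewrite -t1; ring.
  by rewrite mulrCA divff// mulr1.
apply: Qmix => //; last by apply/andP; split; lra.
apply: IH => // [j|]; first by rewrite divr_ge0.
by rewrite -mulr_suml divff.
Qed.

Lemma combinations_mixture_closed (W : Type) (P : set W) (h : W -> V) :
  mixture_closed (combinations P h).
Proof.
move=> _ _ s [m [t [a [t_gt0 t1 Pa ->]]]] [n [u [b [u_gt0 u1 Pb ->]]]].
move=> /andP[s_gt0 s_lt1].
exists (m + n)%N.
exists (fun j : 'I_(m + n) => match fintype.split j with inl i => s * t i | inr i => (1 - s) * u i end).
exists (fun j : 'I_(m + n) => match fintype.split j with inl i => a i | inr i => b i end).
have splitl (i : 'I_m) : fintype.split (lshift n i) = inl i := unsplitK (inl i).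
have splitr (i : 'I_n) : fintype.split (rshift m i) = inr i := unsplitK (inr i).
split.
- by move=> j; case: fintype.split => i; rewrite mulr_gt0// subr_gt0.
- rewrite big_split_ord /=; under eq_bigr do rewrite splitl.
  under [X in _ + X]eq_bigr do rewrite splitr.
  by rewrite -!mulr_sumr t1 u1; ring.
- by move=> j; case: fintype.split.
- rewrite big_split_ord /=; under [X in _ = X + _]eq_bigr do rewrite splitl -scalerA.
  under [X in _ = _ + X]eq_bigr do rewrite splitr -scalerA.
  by rewrite !scaler_sumr.
Qed.

Lemma combinations_sub (W : Type) (P : set W) (h : W -> V) (w : W) :
  P w -> combinations P h (h w).
Proof.
move=> Pw; exists 1, (fun=> 1), (fun=> w); split => //.
- by rewrite big_ord1.
- by rewrite big_ord1 scale1r.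
Qed.

End Mixtures.

(** * Extreme points of a compact convex set *)

Section Minkowski.
Variables (R : realType) (N : nat) (K : set 'rV[R]_N).
Hypotheses (Kcompact : compact K) (Kmix : mixture_closed K).

Let dirs (x v : 'rV[R]_N) : Prop :=
  exists2 e : R, 0 < e & K (x + e *: v) /\ K (x - e *: v).

Let segment x y (s : R) : K x -> K y -> 0 <= s <= 1 -> K (x + s *: (y - x)).
Proof.
move=> Kx Ky /andP[]; rewrite le_eqVlt => /predU1P[<- _|s0].
  by rewrite scale0r addr0.
rewrite le_eqVlt => /predU1P[->|s1]; first by rewrite scale1r subrKC.
have -> : x + s *: (y - x) = s *: y + (1 - s) *: x.
  by rewrite scalerBr scalerBl scale1r addrC -addrA; congr +%R; rewrite addrC.
by apply: Kmix => //; rewrite s0.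
Qed.

Let dirs_shrink x v e : K x -> 0 < e -> K (x + e *: v) ->
  forall r, 0 < r <= e -> K (x + r *: v).
Proof.
move=> Kx e0 Ke r /andP[r0 re].
have -> : x + r *: v = x + (r / e) *: ((x + e *: v) - x).
  by rewrite [_ + _ - x]addrAC subrr add0r scalerA divfK// gt_eqF.
apply: segment => //; apply/andP; split; first by rewrite divr_ge0// ltW.
by rewrite ler_pdivrMr// mul1r.
Qed.

Let dirs0 x : K x -> dirs x 0.
Proof. by move=> Kx; exists 1; rewrite // !scaler0 subr0 addr0. Qed.

Let dirsZ x v a : K x -> dirs x v -> dirs x (a *: v).
Proof.
move=> Kx [e e0 [K1 K2]]; have [->|a0] := eqVneq a 0.
  by rewrite scale0r; exact: dirs0.
have na0 : `|a| != 0 by rewrite normr_eq0.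
exists (e / `|a|); first by rewrite divr_gt0// normr_gt0.
rewrite scalerA; have [age0|alt0] := leP 0 a.
  by rewrite ger0_norm// divfK.
by rewrite ltr0_norm// invrN mulrN mulNr divfK// scaleNr opprK; split.
Qed.

Let dirsD x v w : K x -> dirs x v -> dirs x w -> dirs x (v + w).
Proof.
move=> Kx [e e0 [Ke Ke']] [f f0 [Kf Kf']].
pose r := Num.min e f.
have r0 : 0 < r by rewrite lt_min e0.
have re : 0 < r <= e by rewrite r0 ge_min lexx.
have rf : 0 < r <= f by rewrite r0 ge_min lexx orbT.
rewrite -!scalerN in Ke' Kf'.
have := segment (dirs_shrink Kx e0 Ke re) (dirs_shrink Kx f0 Kf rf).
have := segment (dirs_shrink Kx e0 Ke' re) (dirs_shrink Kx f0 Kf' rf).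
have half01 : 0 <= (2^-1 : R) <= 1 by lra.
move=> /(_ _ half01) H1 /(_ _ half01) H2.
exists (r / 2); first by rewrite divr_gt0.
split.
  suff -> : x + (r / 2) *: (v + w) =
    x + r *: v + 2^-1 *: (x + r *: w - (x + r *: v)) by [].
  by apply/rowP => i; rewrite !mxE; field.
suff -> : x - (r / 2) *: (v + w) =
  x + r *: - v + 2^-1 *: (x + r *: - w - (x + r *: - v)) by [].
by apply/rowP => i; rewrite !mxE; field.
Qed.

Let dirs_submx x m (B : 'M[R]_(m, N)) (v : 'rV[R]_N) :
  K x -> (forall i, dirs x (row i B)) -> (v <= B)%MS -> dirs x v.
Proof.
move=> Kx dB /submxP[u ->]; rewrite mulmx_sum_row.
elim/big_ind: _ => [|y z|i _]; [exact: dirs0|exact: dirsD|].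
exact: dirsZ.
Qed.

(** A ray in a compact set has a last point. *)
Let exit x v : K x -> v != 0 ->
  exists2 a : R, 0 <= a & K (x + a *: v) /\ forall s, a < s -> ~ K (x + s *: v).
Proof.
move=> Kx v0; pose g (t : R) := x + t *: v.
pose E := g @^-1` K `&` [set t | 0 <= t].
have Eclosed : closed E.
  apply: closedI; last exact: closed_ge.
  apply: preimage_closed; last first.
    by apply: compact_closed => //; exact: norm_hausdorff.
  move=> t _; apply: cvgD; first exact: cvg_cst.
  by apply: cvgZr_tmp; exact: cvg_id.
have [M [_ /(_ (M + 1))]] := compact_bounded Kcompact.
rewrite ltrDl ltr01 => /(_ isT) Kbound.
have Ecompact : compact E.
  apply: (subclosed_compact Eclosed (@segment_compact _ 0 ((M + 1 + `|x|) / `|v|))).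
  move=> t [Kt t0]; rewrite /= in_itv/= t0 ler_pdivlMr ?normr_gt0//.
  rewrite -[X in X * _](ger0_norm t0) -normrZ.
  have -> : t *: v = g t - x by rewrite /g addrAC subrr add0r.
  by rewrite (le_trans (ler_normB _ _))// lerD2r Kbound.
have E0 : E !=set0 by exists 0; split; rewrite //= /g scale0r addr0.
have [|a aE amax] := @compact_EVT_max _ R id _ E0 Ecompact.
  by apply: continuous_subspaceT => ?; exact: cvg_id.
move: aE; rewrite inE => -[Ka a0]; exists a => //; split => // s sa Ks.
have : s \in E by rewrite inE; split => //=; rewrite (le_trans a0)// ltW.
by move=> /amax; rewrite leNgt sa.
Qed.

Let exit_gt0 x v : K x -> v != 0 -> dirs x v ->
  exists a : R, [/\ 0 < a, K (x + a *: v) &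
    forall s, a < s -> ~ K (x + s *: v)].
Proof.
move=> Kx v0 [e e0 [Ke _]]; have [a a0 [Ka amax]] := exit Kx v0.
exists a; split => //; rewrite (lt_le_trans e0)// leNgt; apply/negP => ae.
exact: amax Ke.
Qed.

Let extreme_of_nodir x : K x -> (forall v, dirs x v -> v = 0) ->
  extreme_points K x.
Proof.
move=> Kx nodir; split => // y z t Ky Kz /andP[t0 t1] xyz.
suff /eqP yz : y == z by move: xyz; rewrite yz -scalerDl subrKC scale1r.
rewrite -subr_eq0; apply/eqP/nodir.
exists (t * (1 - t)); first by rewrite mulr_gt0 // subr_gt0.
split.
  have -> : x + (t * (1 - t)) *: (y - z) = t *: y + (1 - t) *: x.
    by rewrite xyz; apply/rowP => i; rewrite !mxE; ring.
  by apply: Kmix => //; rewrite t0.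
have -> : x - (t * (1 - t)) *: (y - z) = t *: x + (1 - t) *: z.
  by rewrite xyz; apply/rowP => i; rewrite !mxE; ring.
by apply: Kmix => //; rewrite t0.
Qed.

(** Minkowski's theorem, by induction on the dimension of the space of the
    directions [v] such that [K] contains a segment around [x] parallel to [v].
    If only [v = 0] is such a direction, [x] is extreme. Otherwise [x] lies
    between the points where the line through [x] along [v] leaves [K], and at
    these points the space of directions is smaller, since it lost [v].

    The extreme points that occur have [x] in an open segment of [K] ending at
    them: any property of [x] that faces inherit passes to them. *)
Theorem minkowski (x : 'rV[R]_N) (Q : set 'rV[R]_N) :
  K x -> mixture_closed Q ->
  (forall e, extreme_points K e ->
     (exists (z : 'rV[R]_N) (t : R),
        [/\ K z, 0 < t < 1 & x = t *: e + (1 - t) *: z]) -> Q e) ->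
  Q x.
Proof.
move=> Kx Qmix.
have [n] : exists n, forall m (B : 'M[R]_(m, N)),
    (forall i, dirs x (row i B)) -> (\rank B <= n)%N.
  by exists N => m B _; exact: rank_leq_col.
elim: n x Kx => [|n IH] x Kx dimx Qext.
  have nodir v : dirs x v -> v = 0.
    move=> dv; have := dimx 1 v; rewrite leqn0 mxrank_eq0 => H.
    by apply/eqP/H => i; rewrite row_id.
  apply: Qext; first exact: extreme_of_nodir.
  by exists x, 2^-1; split; [|lra|rewrite -scalerDl subrKC scale1r].
have [[v v0 dv]|nodir] := pselect (exists2 v, v != 0 & dirs x v); last first.
  apply: Qext.
    apply: extreme_of_nodir => // v dv; apply/eqP; apply: contrapT => v0.
    by apply: nodir; exists v => //; exact/negP.
  by exists x, 2^-1; split; [|lra|rewrite -scalerDl subrKC scale1r].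
have [a [a0 Ka amax]] := exit_gt0 Kx v0 dv.
have nv0 : - v != 0 by rewrite oppr_eq0.
have dnv : dirs x (- v) by rewrite -scaleN1r; exact: dirsZ.
have [b [b0 Kb bmax]] := exit_gt0 Kx nv0 dnv.
(* The two ends of the chord play symmetric roles: the directions at an end are
   directions at [x] too, but the direction [w] pointing outwards is lost. *)
suff Qend y z t w : K y -> K z -> 0 < t < 1 -> x = t *: y + (1 - t) *: z ->
    dirs x w -> (forall s, 0 < s -> ~ K (y + s *: w)) -> Q y.
  have ab0 : a + b != 0 by rewrite gt_eqF// addr_gt0.
  have Ht : 0 < b / (a + b) < 1.
    by rewrite divr_gt0 ?addr_gt0//= ltr_pdivrMr ?addr_gt0// mul1r ltrDr.
  have xE : x = (b / (a + b)) *: (x + a *: v) + (1 - b / (a + b)) *: (x + b *: - v).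
    by apply/rowP => i; rewrite !mxE; field.
  rewrite xE; apply: Qmix => //.
    apply: (Qend _ (x + b *: - v) (b / (a + b)) v) => // s s0.
    by rewrite -addrA -scalerDl; apply: amax; rewrite ltrDl.
  apply: (Qend _ (x + a *: v) (1 - (b / (a + b))) (- v)) => //.
  - by move: Ht; lra.
  - by rewrite subKr addrC -xE.
  - move=> s s0; rewrite -addrA -scalerDl; apply: bmax; by rewrite ltrDl.
move=> Ky Kz /andP[t0 t1] xE dw noext; apply: IH => //.
- move=> m B dB; rewrite -ltnS; apply: leq_trans (dimx _ (col_mx w B) _).
    apply: rank_ltmx; rewrite ltmxE; apply/andP; split.
      by rewrite -addsmxE addsmxSr.
    rewrite -addsmxE addsmx_sub submx_refl andbT; apply/negP => wB.
    by have [f f0 [Kf _]] := dirs_submx Ky dB wB; exact: noext Kf.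
  move=> i; rewrite -(splitK i); case: (fintype.split i) => j /=.
    by rewrite rowKu row_id.
  rewrite rowKd; have [f f0 [Kf Kf']] := dB j.
  exists (t * f); first by rewrite mulr_gt0.
  split.
    have -> : x + (t * f) *: row j B = t *: (y + f *: row j B) + (1 - t) *: z.
      by rewrite xE scalerDr scalerA addrAC.
    by apply: Kmix => //; rewrite t0.
  have -> : x - (t * f) *: row j B = t *: (y - f *: row j B) + (1 - t) *: z.
    by rewrite xE scalerBr scalerA addrAC.
  by apply: Kmix => //; rewrite t0.
- move=> f fext [q [s [Kq /andP[s0 s1] yE]]]; apply: Qext => //.
  have ts1 : t * s < 1 by rewrite mulr_ilt1// ltW.
  have ts_neq : 1 - t * s != 0 by rewrite subr_eq0 gt_eqF.
  exists ((t * (1 - s) / (1 - t * s)) *: q + (1 - t * (1 - s) / (1 - t * s)) *: z).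
  exists (t * s); split.
  + apply: Kmix => //; rewrite divr_gt0 ?mulr_gt0 ?subr_gt0//=.
    by rewrite ltr_pdivrMr ?subr_gt0// mul1r; lra.
  + by rewrite mulr_gt0.
  + by rewrite xE yE; apply/rowP => i; rewrite !mxE; field.
Qed.

End Minkowski.

(** * Separating the origin from a compact family *)

Section Separation.
Variables (R : realType) (N : nat).
Local Notation V := 'rV[R]_N.

(** Caratheodory's reduction. The [N.+2] vectors [(1, a j)] of [R^(N+1)] satisfy
    a linear relation [c]; moving the weights along [c] until the first of them
    vanishes changes neither their sum nor the combination. *)
Lemma caratheodory (t : 'I_N.+2 -> R) (a : 'I_N.+2 -> V) :
  (forall j, 0 <= t j) ->
  exists (t' : 'I_N.+1 -> R) (j0 : 'I_N.+2),
    [/\ forall j, 0 <= t' j,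
        \sum_(j < N.+1) t' j = \sum_(j < N.+2) t j
      & \sum_(j < N.+1) t' j *: a (lift j0 j) = \sum_(j < N.+2) t j *: a j].
Proof.
move=> t_ge0.
pose M : 'M[R]_(N.+2, 1 + N) := row_mx (const_mx 1) (\matrix_j a j).
have : kermx M != 0.
  rewrite kermx_eq0 /row_free neq_ltn; apply/orP; left.
  exact: leq_ltn_trans (rank_leq_col M) (leqnn _).
case/rowV0Pn => c /sub_kermxP; rewrite /M mul_mx_row => cM c0.
have /eqP := cM; rewrite row_mx_eq0 => /andP[/eqP sum_c /eqP sum_ca].
have {sum_c} sum_c : \sum_j c 0 j = 0.
  transitivity ((c *m const_mx 1 : 'rV[R]_1) 0 0); last by rewrite sum_c mxE.
  by rewrite mxE; apply: eq_bigr => j _; rewrite mxE mulr1.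
have {sum_ca} sum_ca : \sum_j c 0 j *: a j = 0.
  transitivity (c *m \matrix_j a j) => //; rewrite mulmx_sum_row; apply: eq_bigr => j _.
  by rewrite rowK.
have [j1 cj1] : exists j, 0 < c 0 j.
  apply: contrapT => /forallNP c_le0; case/negP: c0; apply/eqP/rowP => j.
  have {}c_le0 i : c 0 i <= 0 by rewrite leNgt; apply/negP/c_le0.
  have : \sum_j - c 0 j == 0 by rewrite sumrN sum_c oppr0.
  rewrite psumr_eq0 => [/allP/(_ j)|i _]; last by rewrite oppr_ge0.
  by rewrite mem_index_enum oppr_eq0 mxE => /(_ isT)/eqP.
have [j0 cj0 j0min] := @arg_minP _ _ _ j1 (fun j => 0 < c 0 j) (fun j => t j / c 0 j) cj1.
pose r := t j0 / c 0 j0; pose t' j := t j - r * c 0 j.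
have t'j0 : t' j0 = 0 by rewrite /t' /r divfK ?subrr// gt_eqF.
have t'_ge0 j : 0 <= t' j.
  rewrite subr_ge0; have [cj|cj] := ltP 0 (c 0 j).
    by rewrite -ler_pdivlMr//; exact: j0min.
  by rewrite (le_trans _ (t_ge0 j))// mulr_ge0_le0// divr_ge0// ltW.
exists (fun j => t' (lift j0 j)), j0; split => //.
- transitivity (\sum_j t' j); first by rewrite [RHS](bigD1_ord j0)//= t'j0 add0r.
  by rewrite sumrB -mulr_sumr sum_c mulr0 subr0.
- transitivity (\sum_j t' j *: a j).
    by rewrite [RHS](bigD1_ord j0)//= t'j0 scale0r add0r.
  under eq_bigr do rewrite scalerBl -scalerA.
  by rewrite sumrB -scaler_sumr sum_ca scaler0 subr0.
Qed.

Local Notation "<< u , v >>" := (\sum_(l < N) u 0 l * v 0 l).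

(** Two cases according to the point [u] of least Euclidean norm in the convex
    hull of [h @` P], which exists since by Caratheodory's reduction the
    combinations of [N.+1] points, which form a compact set, exhaust the hull:
    either [u = 0], or [u] itself separates, because the segment from [u] to
    [h w] comes no closer to [0] than [u] does. *)
Lemma separation_or_balance (W : ptopologicalType) (P : set W) (h : W -> V) :
  compact P -> (forall l, continuous (fun w => h w 0 l)) ->
  (exists u : V, forall w, P w -> 0 < <<u, h w>>) \/
  (forall Q : set V, mixture_closed Q -> (forall w, P w -> Q (h w)) -> Q 0).
Proof.
move=> Pcompact hcont.
have [[w0 Pw0]|P0] := pselect (P !=set0); last first.
  by left; exists 0 => w Pw; case: P0; exists w.
pose weighted := ('rV[R]_N.+1 * 'rV[W]_N.+1)%type.
pose C : set weighted :=
  ([set t : 'rV[R]_N.+1 | forall j, `[0, 1]%classic (t 0 j)] `*`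
   [set a : 'rV[W]_N.+1 | forall j, P (a 0 j)]) `&`
  [set c : weighted | \sum_j c.1 0 j = 1].
pose z (c : weighted) : V := \sum_j c.1 0 j *: h (c.2 0 j).
have c1_cont j : continuous (fun c : weighted => c.1 0 j).
  move=> c; apply: (cvg_comp (fun c : weighted => c.1) (fun t => t 0 j)).
    exact: cvg_fst.
  exact: coord_continuous.
have c2_cont j : continuous (fun c : weighted => c.2 0 j).
  move=> c; apply: (cvg_comp (fun c : weighted => c.2) (fun a => a 0 j)).
    exact: cvg_snd.
  move=> A cA; exists (\matrix_(i, l) if l == j then A else setT).
    by move=> i l; rewrite mxE; case: eqP => [->|_]; [rewrite ord1|exact: filterT].
  by move=> c' /(_ 0 j); rewrite /= mxE eqxx.
have Ccompact : compact C.
  apply: compact_closedI.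
    apply: compact_setX; last exact: (@rV_compact _ _ (fun=> P)).
    apply: (@rV_compact R _ (fun=> `[0, 1]%classic)) => _.
    exact: segment_compact.
  apply: (@preimage_closed weighted R (fun c : weighted => \sum_j c.1 0 j) [set 1]).
    move=> c _; apply: cvg_big => [|j _]; last exact: c1_cont.
    exact: add_continuous.
  exact: closed_eq.
have C0 : C !=set0.
  exists (\row_j (j == 0)%:R, \row_j w0); split => /=.
    split=> j /=; rewrite mxE // in_itv/=.
    by case: eqP => _; rewrite ?lexx ?ler01.
  rewrite (bigD1 ord0)//= mxE eqxx/= big1 ?addr0// => j j0.
  by rewrite mxE (negbTE j0).
pose q (v : V) := <<v, v>>.
have zcont l : continuous (fun c => z c 0 l).
  have -> : (fun c => z c 0 l) =
      (fun c : weighted => \sum_j c.1 0 j * h (c.2 0 j) 0 l).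
    by apply/funext => c; rewrite summxE; apply: eq_bigr => j _; rewrite mxE.
  move=> c; apply: cvg_big => [|j _]; first exact: add_continuous.
  apply: cvgM; first exact: c1_cont.
  exact: (cvg_comp _ _ (@c2_cont j c) (hcont l _)).
have [|c cC cmin] := @compact_EVT_min _ R (q \o z) C C0 Ccompact.
  apply: continuous_subspaceT => c; apply: cvg_big => [|l _].
    exact: add_continuous.
  by apply: cvgM; exact: zcont.
move: cC; rewrite inE => -[[c01 cW] c1].
have c_ge0 j : 0 <= c.1 0 j by have /= := c01 j; rewrite in_itv/= => /andP[].
set u := z c in cmin.
have [u0|u_neq0] := eqVneq (q u) 0.
  right=> Q Qmix hQ.
  have <- : u = 0.
    apply/rowP => l; rewrite mxE; move/eqP: u0.
    rewrite psumr_eq0 => [/allP/(_ l)|i _]; last by rewrite -expr2 sqr_ge0.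
    by rewrite mem_index_enum mulf_eq0 orbb => /(_ isT)/eqP.
  by apply: mixture_closed_sum => // j; exact: hQ.
left; exists u => w Pw.
have q_gt0 : 0 < q u.
  by rewrite lt_def u_neq0/= sumr_ge0// => l _; rewrite -expr2 sqr_ge0.
(* A point of the segment from [u] to [h w] combines [N.+2] points, which
   Caratheodory's reduction brings back to the set minimized over. *)
have near s : 0 < s < 1 -> q u <= q (u + s *: (h w - u)).
  move=> /andP[s0 s1].
  pose t j := if unlift ord0 j is Some i then (1 - s) * c.1 0 i else s.
  pose b j := if unlift ord0 j is Some i then c.2 0 i else w.
  have t_ge0 j : 0 <= t j.
    by rewrite /t; case: unlift => [i|]; rewrite ?mulr_ge0// ?subr_ge0 ltW.
  have bP j : P (b j) by rewrite /b; case: unlift.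
  have sum_t : \sum_j t j = 1.
    rewrite big_ord_recl /t unlift_none; under eq_bigr do rewrite liftK.
    by rewrite -mulr_sumr c1 mulr1 subrKC.
  have [t' [j0 [t'_ge0 t'1 t'z]]] := caratheodory (h \o b) t_ge0.
  have -> : u + s *: (h w - u) = z (\row_j t' j, \row_j b (lift j0 j)).
    rewrite /z; under [RHS]eq_bigr do rewrite !mxE.
    rewrite t'z big_ord_recl /t /b /= unlift_none.
    under eq_bigr do rewrite liftK -scalerA.
    by rewrite -scaler_sumr -/(z c) -/u scalerBr scalerBl scale1r addrCA.
  apply: cmin; rewrite inE; split => /=; last first.
    by under eq_bigr do rewrite mxE; rewrite t'1.
  split=> j /=; rewrite mxE // in_itv/= t'_ge0/=.
  by rewrite -sum_t -t'1 (bigD1 j)//= lerDl sumr_ge0.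
pose D := q (h w - u).
pose g := <<u, h w>> - q u.
have qE s : q (u + s *: (h w - u)) = q u + s * (2 * g + s * D).
  rewrite /q /g /D /q !mulr_sumr -!sumrB !mulr_sumr -!big_split/=.
  rewrite mulr_sumr -big_split/=; apply: eq_bigr => l _.
  by rewrite !mxE; ring.
have {}near s : 0 < s < 1 -> 0 <= 2 * g + s * D.
  by move=> s01; have := near s s01; rewrite qE lerDl pmulr_rge0//; case/andP: s01.
have D_ge0 : 0 <= D by rewrite sumr_ge0// => l _; rewrite -expr2 sqr_ge0.
suff : 0 <= g by rewrite subr_ge0; exact: lt_le_trans.
rewrite leNgt; apply/negP => g0.
have := near (- g / (D - g)).
have Dg : 0 < D - g by lra.
rewrite divr_gt0 ?oppr_gt0//= ltr_pdivrMr// mul1r.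
have [D0|D0] := eqVneq D 0; first by have := near 2^-1; rewrite D0; lra.
have {}D0 : 0 < D by rewrite lt_def D0.
have -> : - g < D - g by lra.
move=> /(_ isT); suff : - g / (D - g) * D < - g by lra.
by rewrite -mulrA gtr_pMr ?oppr_gt0// mulrC ltr_pdivrMr// mul1r; lra.
Qed.

End Separation.

(** * The scalar field over the reals *)

Lemma scalar_abs_complex (R : realType) (a : scalar_field R ComplexScalars) :
  scalar_abs a = Num.sqrt (complex.Re a ^+ 2 + complex.Im a ^+ 2).
Proof. exact: (congr1 (@complex.Re R) (normc_def (a : R[i]))). Qed.

Section Scalars.
Variables (R : realType) (k : scalar_kind).
Local Notation F := (scalar_field R k).
Local Notation io := (@scalar_of_real R k).
Local Notation re := (@scalar_re R k).
Local Notation abs := (@scalar_abs R k).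
Local Notation conj := (@scalar_conj R k).

Lemma scalar_of_realD : {morph io : s t / s + t}.
Proof. by case: k => //= s t; rewrite /GRing.add /= addr0. Qed.

Lemma scalar_of_realM : {morph io : s t / s * t}.
Proof. by case: k => //= s t; apply/eqP; rewrite eq_complex /= !mulr0 !mul0r subr0 addr0 !eqxx. Qed.

Lemma scalar_of_real0 : io 0 = 0. Proof. by case: k. Qed.
Lemma scalar_of_real1 : io 1 = 1. Proof. by case: k. Qed.

Lemma scalar_of_realN : {morph io : s / - s}.
Proof. by move=> s; apply/eqP; rewrite -addr_eq0 -scalar_of_realD addNr scalar_of_real0. Qed.

Lemma scalar_of_realB : {morph io : s t / s - t}.
Proof. by move=> s t; rewrite scalar_of_realD scalar_of_realN. Qed.

Lemma scalar_reK : cancel io re. Proof. by case: k. Qed.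

Lemma ler_scalar_of_real s t : (io s <= io t) = (s <= t).
Proof. by case: k => //=; rewrite lecE /= eqxx. Qed.

Lemma ltr_scalar_of_real s t : (io s < io t) = (s < t).
Proof. by case: k => //=; rewrite ltcE /= eqxx. Qed.

Lemma scalar_reD : {morph re : a b / a + b}.
Proof. by case: k => // -[? ?] [? ?]. Qed.

Lemma scalar_reN : {morph re : a / - a}.
Proof. by case: k => // -[? ?]. Qed.

Lemma scalar_reB : {morph re : a b / a - b}.
Proof. by move=> a b; rewrite scalar_reD scalar_reN. Qed.

Lemma scalar_re0 : re 0 = 0. Proof. by case: k. Qed.
Lemma scalar_re1 : re 1 = 1. Proof. by case: k. Qed.

Lemma scalar_reZ t a : re (io t * a) = t * re a.
Proof. by case: k a => // -[? ?] /=; rewrite mul0r subr0. Qed.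

Lemma scalar_re_sum (I : Type) (r : seq I) (P : pred I) (f : I -> F) :
  re (\sum_(i <- r | P i) f i) = \sum_(i <- r | P i) re (f i).
Proof. exact: (big_morph re scalar_reD scalar_re0). Qed.

Lemma scalar_of_real_re (a : F) : a \is Num.real -> io (re a) = a.
Proof.
case: k a => //= -[x y]; rewrite realE !lecE /=.
by rewrite [0 == y]eq_sym => /orP[] /andP[/eqP ->].
Qed.

Lemma scalar_absE a : io (abs a) = `|a|.
Proof. by rewrite scalar_of_real_re// normr_real. Qed.

Lemma scalar_abs_ge0 a : 0 <= abs a.
Proof. by rewrite -ler_scalar_of_real scalar_absE scalar_of_real0. Qed.

Lemma scalar_absM : {morph abs : a b / a * b}.
Proof. by move=> a b; rewrite -[RHS]scalar_reK scalar_of_realM !scalar_absE -normrM. Qed.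

Lemma scalar_abs0 : abs 0 = 0.
Proof. by rewrite /scalar_abs normr0 scalar_re0. Qed.

Lemma scalar_abs1 : abs 1 = 1.
Proof. by rewrite /scalar_abs normr1 -scalar_of_real1 scalar_reK. Qed.

Lemma scalar_absN a : abs (- a) = abs a.
Proof. by rewrite /scalar_abs normrN. Qed.

Lemma scalar_abs_eq0 a : (abs a == 0) = (a == 0).
Proof. by rewrite -[a == 0]normr_eq0 -scalar_absE -scalar_of_real0 (can_eq scalar_reK). Qed.

Lemma scalar_abs_of_real t : abs (io t) = `|t|.
Proof.
case: (leP 0 t) => t0.
  by rewrite /scalar_abs !ger0_norm ?scalar_reK// -scalar_of_real0 ler_scalar_of_real.
rewrite /scalar_abs !ltr0_norm ?scalar_reN ?scalar_reK//.
by rewrite -scalar_of_real0 ltr_scalar_of_real.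
Qed.

Lemma scalar_conjD : {morph conj : a b / a + b}.
Proof. by case: k => // -[? ?] [? ?]; apply/eqP; rewrite eq_complex /= opprD !eqxx. Qed.

Lemma scalar_conj0 : conj 0 = 0.
Proof. by case: k => //=; rewrite /conjc /= oppr0. Qed.

Lemma scalar_conjN : {morph conj : a / - a}.
Proof. by move=> a; apply/eqP; rewrite -addr_eq0 -scalar_conjD addNr scalar_conj0. Qed.

Lemma scalar_re_conjM a b : re (conj a * b) = re (conj b * a).
Proof. by case: k a b => [? ?|[? ?] [? ?]] /=; ring. Qed.

Lemma scalar_re_conj_sqr a : re (conj a * a) = abs a ^+ 2.
Proof.
case: k a => [a|[x y]]; first by rewrite /= real_normK ?num_real// expr2.
rewrite scalar_abs_complex /= sqr_sqrtr ?addr_ge0 ?sqr_ge0//; ring.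
Qed.

Lemma scalar_abs_conj a : abs (conj a) = abs a.
Proof. by case: k a => // -[x y]; rewrite !scalar_abs_complex /= sqrrN. Qed.

Lemma ler_scalar_re_abs a : re a <= abs a.
Proof.
case: k a => [a|[x y]]; first exact: ler_norm.
rewrite scalar_abs_complex /= (le_trans (ler_norm x))// -sqrtr_sqr.
by rewrite ler_wsqrtr// lerDl sqr_ge0.
Qed.

Lemma ler_scalar_re_conjM a b : re (conj a * b) <= abs a * abs b.
Proof. by rewrite -(scalar_abs_conj a) -scalar_absM ler_scalar_re_abs. Qed.

(** A single name for the number whose multiples by reals, together with the
    reals, exhaust the scalars: the imaginary unit, and [0] over the reals. *)
Definition scalar_im_unit : F :=
  match k with RealScalars => 0 | ComplexScalars => 'i%C end.
Local Notation im := scalar_im_unit.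

Lemma scalar_decomp a : a = io (re a) - im * io (re (im * a)).
Proof.
rewrite /scalar_im_unit; case: k a => [a|[x y]] /=; first by rewrite mul0r subr0.
by apply/eqP; rewrite eq_complex; apply/andP; split; apply/eqP => /=; ring.
Qed.

Lemma scalar_re_im_real t : re (im * io t) = 0.
Proof. by rewrite /scalar_im_unit; case: k => /=; ring. Qed.

Lemma scalar_abs_sqr a : abs a ^+ 2 = re a ^+ 2 + re (im * a) ^+ 2.
Proof.
rewrite -scalar_re_conj_sqr /scalar_im_unit.
by case: k a => [a|[x y]] /=; ring.
Qed.

Lemma scalar_eq1 a : abs a <= 1 -> re a = 1 -> a = 1.
Proof.
move=> a1 re_a; have : re (im * a) ^+ 2 <= 0.
  have := scalar_abs_sqr a; have : abs a ^+ 2 <= 1.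
    by rewrite expr_le1 ?scalar_abs_ge0.
  by rewrite re_a; lra.
rewrite real_exprn_even_le0 ?num_real//= => /eqP im_a.
by rewrite (scalar_decomp a) re_a im_a scalar_of_real0 scalar_of_real1 mulr0 subr0.
Qed.

(** [1] is an extreme point of the unit disc: a functional of norm at most [1]
    that is [1] at a mixture of points of the unit ball is [1] at these points. *)
Lemma scalar_mixture_eq1 (a b : F) t : abs a <= 1 -> abs b <= 1 -> 0 < t < 1 ->
  io t * a + io (1 - t) * b = 1 -> a = 1 /\ b = 1.
Proof.
move=> a1 b1 /andP[t0 t1] /(congr1 re).
rewrite scalar_reD !scalar_reZ scalar_re1 => ab.
have ra := le_trans (ler_scalar_re_abs a) a1.
have rb := le_trans (ler_scalar_re_abs b) b1.
by split; apply: scalar_eq1 => //; nra.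
Qed.

Lemma scalar_phase a : exists2 u, abs u = 1 & u * a = io (abs a).
Proof.
have [->|a0] := eqVneq a 0.
  by exists 1; rewrite ?scalar_abs1// mulr0 scalar_abs0 scalar_of_real0.
have A0 : abs a != 0 by rewrite scalar_abs_eq0.
have iA0 : io (abs a) != 0 by rewrite scalar_absE normr_eq0.
exists (io (abs a) / a); last by rewrite divfK.
apply/(can_inj scalar_reK); rewrite scalar_of_real1 scalar_absE normrM normfV.
by rewrite scalar_absE normr_id divff// normr_eq0.
Qed.

Lemma scalar_re_im_eq0 a : k = RealScalars -> re (im * a) = 0.
Proof. by rewrite /scalar_im_unit; case: k a => //= a; rewrite mul0r. Qed.

Lemma scalar_im_unit_sqr :
  exists2 e, im * im = io e & forall a, re (im * a) * e = - re (im * a).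
Proof.
rewrite /scalar_im_unit; case: k.
  by exists 0 => [|a] /=; rewrite !mul0r// oppr0.
exists (-1) => [|a]; last by rewrite mulrN1.
by apply/eqP; rewrite eq_complex; apply/andP; split; apply/eqP => /=; ring.
Qed.

(** The functional [x |-> rho x - i rho (i x)] with real part [rho]; over the
    reals the second term vanishes. *)
Definition complexify (V : lmodType F) (rho : V -> R) : V -> F^o :=
  fun x => io (rho x) - im * io (rho (im *: x)).

Lemma scalar_re_complexify (V : lmodType F) (rho : V -> R) x :
  re (complexify rho x) = rho x.
Proof. by rewrite scalar_reB scalar_reK scalar_re_im_real subr0. Qed.

Lemma complexify_linear (V : lmodType F) (rho : V -> R) :
  (forall x y, rho (x + y) = rho x + rho y) ->
  (forall t x, rho (io t *: x) = t * rho x) ->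
  linear (complexify rho).
Proof.
move=> rhoD rhoZ a x y; rewrite /complexify.
pose s := - re (im * a); pose r := re a.
have aE : a = io r + im * io s.
  by rewrite {1}(scalar_decomp a) scalar_of_realN mulrN.
have rho_aD z : rho (a *: z) = r * rho z + s * rho (im *: z).
  by rewrite aE scalerDl rhoD rhoZ [im * _]mulrC -scalerA rhoZ.
have [e im2 ime] := scalar_im_unit_sqr.
have s_im2 z : s * rho (im *: (im *: z)) = - (s * rho z).
  by rewrite scalerA im2 rhoZ mulrA /s mulNr ime; ring.
have s_real : k = RealScalars -> s = 0.
  by move=> kE; rewrite /s scalar_re_im_eq0// oppr0.
rewrite scalerDr scalerA [im * a]mulrC -scalerA !rhoD !rho_aD s_im2 {rho_aD s_im2}.
move: (rho x) (rho y) (rho (im *: x)) (rho (im *: y)) => X P Y Q.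
rewrite aE {aE} /scalar_im_unit /GRing.scale /=.
move: r s s_real => r s; case: k => [s0|_] /=; first by rewrite s0//; ring.
by apply/eqP; rewrite eq_complex; apply/andP; split; apply/eqP => /=; ring.
Qed.

End Scalars.

(** * The derivative of the power of the modulus *)

(** With [x = expR y], the strict inequality [1 + z < expR z] at
    [z = (p - 1) * y] and at [z = - y], multiplied by [x] and averaged with
    weights [p^-1] and [1 - p^-1], gives [x < p^-1 * x `^ p + (1 - p^-1)]. *)
Lemma bernoulli_powR (R : realType) (p x : R) :
  1 < p -> 0 <= x -> x != 1 -> 1 + p * (x - 1) < x `^ p.
Proof.
move=> p1; rewrite le_eqVlt => /predU1P[<- _|x0 x1].
  by rewrite powR0 ?gt_eqF//; lra.
have lnx : ln x != 0 by rewrite ln_eq0// ; apply/negbTE.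
pose y := ln x; have xE : x = expR y by rewrite lnK.
have p10 : p - 1 != 0 by rewrite subr_eq0 gt_eqF.
have ny0 : - y != 0 by rewrite oppr_eq0.
have := expR_gt1Dx ny0; have := expR_gt1Dx (mulf_neq0 p10 lnx).
rewrite -/y expRN -xE => H1.
rewrite -(@ltr_pM2l _ x)// divff ?gt_eqF// => H2.
have : expR (p * y) = x * expR ((p - 1) * y).
  by rewrite xE -expRD; congr expR; ring.
have -> : x `^ p = expR (p * y) by rewrite /powR gt_eqF.
move: H1; rewrite -(@ltr_pM2l _ x)// => H1 ->.
have p1' : 0 < p - 1 by rewrite subr_gt0.
by move: H2; rewrite -(ltr_pM2l p1'); lra.
Qed.

Section ConjPow.
Variables (R : realType) (k : scalar_kind) (p : R).
Hypothesis p_gt1 : 1 < p.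
Local Notation F := (scalar_field R k).
Local Notation io := (@scalar_of_real R k).
Local Notation re := (@scalar_re R k).
Local Notation abs := (@scalar_abs R k).
Local Notation conj := (@scalar_conj R k).

Let p_neq0 : p != 0. Proof. by rewrite gt_eqF// (lt_trans ltr01). Qed.

Lemma conj_pow0 : conj_pow p 0 = 0 :> F.
Proof. by rewrite /conj_pow scalar_conj0 mul0r. Qed.

Lemma scalar_re_conj_powM (a b : F) :
  re (conj_pow p a * b) = abs a `^ (p - 2) * re (conj a * b).
Proof. by rewrite /conj_pow mulrAC mulrC scalar_reZ. Qed.

Lemma conj_powM_re (a : F) : re (conj_pow p a * a) = abs a `^ p.
Proof.
rewrite scalar_re_conj_powM scalar_re_conj_sqr -powR_mulrn ?scalar_abs_ge0//.
have [->|A0] := eqVneq (abs a) 0.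
  by rewrite [X in _ * X]powR0 ?pnatr_eq0// mulr0 powR0.
by rewrite -powRD ?A0 ?implybT// subrK.
Qed.

(** The tangent to [b |-> abs b `^ p] at [a] lies below it, strictly away from
    [a]: by Cauchy-Schwarz this reduces to the moduli, where it is Bernoulli's
    inequality at [abs b / abs a]; for equal moduli the strictness comes from
    Cauchy-Schwarz. *)
Lemma tangent_lt (a b : F) : a != b ->
  abs a `^ p + p * re (conj_pow p a * (b - a)) < abs b `^ p.
Proof.
have [->|a0] := eqVneq a 0.
  move=> b0; rewrite conj_pow0 mul0r scalar_re0 mulr0 addr0 scalar_abs0 powR0//.
  by rewrite powR_gt0// lt_def scalar_abs_ge0 scalar_abs_eq0 eq_sym b0.
move=> ab; have A0 : 0 < abs a by rewrite lt_def scalar_abs_ge0 scalar_abs_eq0 a0.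
have A'0 : abs a != 0 by rewrite gt_eqF.
have p0 : 0 < p := lt_trans ltr01 p_gt1.
pose q := abs a `^ (p - 2); have q0 : 0 < q by rewrite powR_gt0.
have pE : abs a `^ p = q * abs a ^+ 2.
  by rewrite -conj_powM_re scalar_re_conj_powM scalar_re_conj_sqr.
rewrite scalar_re_conj_powM -/q mulrBr scalar_reB scalar_re_conj_sqr.
have cs := ler_scalar_re_conjM a b; set C := re _ in cs *.
have [ABeq|AB] := eqVneq (abs b) (abs a).
  have : 0 < abs (b - a) ^+ 2 by rewrite exprn_gt0// lt_def scalar_abs_ge0 scalar_abs_eq0 subr_eq0 eq_sym ab.
  rewrite -scalar_re_conj_sqr scalar_conjD scalar_conjN mulrDl !mulrDr.
  rewrite !mulNr !mulrN !scalar_reD !scalar_reN !scalar_re_conj_sqr.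
  rewrite opprK [re (conj b * a)]scalar_re_conjM -/C ABeq => H.
  have : p * (q * (C - abs a ^+ 2)) < 0 by rewrite pmulr_rlt0// pmulr_rlt0//; lra.
  lra.
pose x := abs b / abs a.
have x1 : x != 1 by rewrite /x -(divff A'0) (can_eq (mulfVK _))// eqr_div//.
have bE : abs b = x * abs a by rewrite divfK.
have x0 : 0 <= x by rewrite divr_ge0// scalar_abs_ge0.
rewrite bE (powRM _ x0 (ltW A0)) pE.
have := bernoulli_powR p_gt1 x0 x1.
rewrite -(@ltr_pM2r _ (q * abs a ^+ 2)); last by rewrite mulr_gt0 ?exprn_gt0.
apply: le_lt_trans; rewrite bE in cs.
have : q * (C - abs a ^+ 2) <= q * (abs a * (x * abs a) - abs a ^+ 2).
  by rewrite ler_pM2l// lerD2r.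
move=> /(ler_wpM2l (ltW p0)) H; rewrite -subr_ge0 in H; rewrite -subr_ge0.
by apply: le_trans H _; rewrite le_eqVlt; apply/orP; left; apply/eqP; ring.
Qed.

Lemma tangent_le (a b : F) :
  abs a `^ p + p * re (conj_pow p a * (b - a)) <= abs b `^ p.
Proof.
have [->|ab] := eqVneq a b; last exact/ltW/tangent_lt.
by rewrite subrr mulr0 scalar_re0 mulr0 addr0.
Qed.

(** ** Continuity *)

Lemma scalar_re_continuous : continuous (re : F -> R).
Proof.
move=> a; apply/(@cvgrPdist_lt R R^o F (nbhs a) (nbhs_filter a)) => e e0.
have io_e0 : 0 < io e by rewrite -scalar_of_real0 ltr_scalar_of_real.
apply/nbhs_normP; exists (io e) => //= b ab.
have : abs (a - b) < e by rewrite -(@ltr_scalar_of_real R k) scalar_absE.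
apply: le_lt_trans; rewrite -scalar_reB ler_norml ler_scalar_re_abs andbT.
by rewrite lerNl -scalar_reN -scalar_absN ler_scalar_re_abs.
Qed.

Lemma scalar_of_real_continuous : continuous (io : R -> F).
Proof.
move=> s; apply/(@cvgrPdist_lt F F^o R (nbhs s) (nbhs_filter s)) => e e0.
have eE : e = io (re e) by rewrite scalar_of_real_re// gtr0_real.
have re_e0 : 0 < re e by rewrite -(@ltr_scalar_of_real R k) -eE scalar_of_real0.
apply/nbhs_normP; exists (re e) => //= t st.
suff : `|(io s - io t : F)| < e by [].
by rewrite -scalar_of_realB -scalar_absE scalar_abs_of_real eE ltr_scalar_of_real.
Qed.

Lemma scalar_conj_continuous : continuous (conj : F -> F).
Proof.
move=> a; apply/(@cvgrPdist_lt F F^o F (nbhs a) (nbhs_filter a)) => e e0.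
apply/nbhs_normP; exists e => //= b ab.
suff : `|(conj a - conj b : F)| < e by [].
by rewrite -scalar_conjN -scalar_conjD -scalar_absE scalar_abs_conj scalar_absE.
Qed.

Lemma scalar_abs_continuous : continuous (abs : F -> R).
Proof.
move=> a; apply: (cvg_comp (fun a : F => `|a|) re); first exact: (@norm_continuous F F^o).
exact: scalar_re_continuous.
Qed.

Lemma scalar_abs_conj_pow (a : F) : abs (conj_pow p a) = abs a `^ (p - 1).
Proof.
rewrite /conj_pow scalar_absM scalar_abs_conj scalar_abs_of_real.
rewrite ger0_norm ?powR_ge0//.
have [->|A0] := eqVneq (abs a) 0.
  by rewrite mul0r powR0// subr_eq0 gt_eqF.
rewrite -{1}(powRr1 (scalar_abs_ge0 a)) -powRD ?A0 ?implybT//.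
by congr (_ `^ _); ring.
Qed.

(** At [0] the power [p - 2] may be negative, but the modulus
    [abs a `^ (p - 1)] still tends to [0]. *)
Lemma conj_pow_continuous : continuous (conj_pow p : F -> F).
Proof.
move=> a; have [->|a0] := eqVneq a 0.
  rewrite /continuous_at conj_pow0; apply/(@cvgr0Pnorm_lt F F^o F (nbhs 0) (nbhs_filter (0 : F))) => e e0.
  have eE : e = io (re e) by rewrite scalar_of_real_re// gtr0_real.
  have re_e0 : 0 < re e by rewrite -(@ltr_scalar_of_real R k) -eE scalar_of_real0.
  have p1 : 0 < p - 1 by rewrite subr_gt0.
  have d0 : 0 < io (re e `^ (p - 1)^-1).
    by rewrite -scalar_of_real0 ltr_scalar_of_real powR_gt0.
  apply/nbhs_normP; exists (io (re e `^ (p - 1)^-1)) => //= b b0.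
  have bd : abs b < re e `^ (p - 1)^-1.
    by rewrite -(@ltr_scalar_of_real R k) scalar_absE -normrN -sub0r.
  suff : `|(conj_pow p b : F)| < e by [].
  rewrite -scalar_absE eE ltr_scalar_of_real scalar_abs_conj_pow.
  have -> : re e = (re e `^ (p - 1)^-1) `^ (p - 1).
    by rewrite -powRrM mulVf ?gt_eqF// powRr1// ltW.
  by apply: gt0_ltr_powR => //; rewrite nnegrE ?scalar_abs_ge0 ?powR_ge0.
have A0 : 0 < abs a by rewrite lt_def scalar_abs_ge0 scalar_abs_eq0 a0.
have powR_cont : {for abs a, continuous (fun r : R => r `^ (p - 2))}.
  apply: differentiable_continuous; apply/derivable1_diffP.
  by apply: derivable_powR; rewrite in_itv/= A0.
have -> : conj_pow p = (fun b : F => conj b * io (abs b `^ (p - 2))).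
  by apply/funext.
apply: (@cvgM F F (nbhs a)); first exact: scalar_conj_continuous.
apply: (cvg_comp (fun b : F => abs b `^ (p - 2)) io); last exact: scalar_of_real_continuous.
apply: (cvg_comp abs (fun r => r `^ (p - 2))); first exact: scalar_abs_continuous.
exact: powR_cont.
Qed.

Lemma scalar_abs_powR_continuous : continuous (fun a : F => abs a `^ p).
Proof.
have -> : (fun a : F => abs a `^ p) = re \o (fun a => conj_pow p a * a).
  by apply/funext => a; rewrite /= conj_powM_re.
move=> a; apply: continuous_comp; last exact: scalar_re_continuous.
by apply: (@cvgM F F (nbhs a)); [exact: conj_pow_continuous|exact: cvg_id].
Qed.

End ConjPow.

(** * Real coordinates on a finite-dimensional space *)

Section RealBasis.
Variables (R : realType) (k : scalar_kind) (V : lmodType (scalar_field R k)).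
Local Notation F := (scalar_field R k).
Local Notation io := (@scalar_of_real R k).
Local Notation re := (@scalar_re R k).

Let real_spanning (n : nat) : Prop :=
  exists u : 'I_n -> V, forall x, exists c : 'I_n -> R,
    x = \sum_(l < n) io (c l) *: u l.

(** Scalars are real combinations of [1] and of the imaginary unit, so that
    twice as many vectors span over the reals; a spanning family of least size
    is a basis, as a dependent member could be dropped. *)
Lemma exists_real_basis : finite_dim V ->
  exists (N : nat) (u : 'I_N -> V) (kappa : V -> 'rV[R]_N),
    (forall x, x = \sum_(l < N) io (kappa x 0 l) *: u l) /\
    (forall c : 'rV[R]_N, kappa (\sum_(l < N) io (c 0 l) *: u l) = c).
Proof.
move=> [n [e espan]].
have span2n : `[< real_spanning (n + n) >].
  apply/asboolP; pose im : F := scalar_im_unit R k.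
  exists (fun j => match fintype.split j with inl i => e i | inr i => im *: e i end) => x.
  have [c ->] := espan x.
  exists (fun j => match fintype.split j with
     inl i => re (c i) | inr i => - re (im * c i) end).
  rewrite big_split_ord /= -big_split /=; apply: eq_bigr => i _.
  rewrite (unsplitK (inl i)) (unsplitK (inr i)) {1}(scalar_decomp (c i)).
  by rewrite scalerBl scalar_of_realN scaleNr scalerA [im * io _]mulrC.
have [N /asboolP[u uspan] Nmin] := ex_minnP (ex_intro (fun n => `[< real_spanning n >]) _ span2n).
have free (c : 'I_N -> R) : \sum_l io (c l) *: u l = 0 -> forall l, c l = 0.
  move=> c0 j; apply: contrapT => /eqP cj.
  have iocj : io (c j) != 0.
    by rewrite -(@scalar_of_real0 R k) (can_eq (@scalar_reK R k)).
  case: N u uspan Nmin c c0 j cj iocj => [|N] u uspan Nmin c c0 j cj iocj; first by case: j cj iocj.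
  suff : `[< real_spanning N >] by move=> /Nmin; rewrite ltnn.
  apply/asboolP; exists (u \o lift j) => x; have [b ->] := uspan x.
  exists (fun l => b (lift j l) - b j / c j * c (lift j l)).
  have -> : \sum_l io (b l) *: u l =
      \sum_l io (b l) *: u l - io (b j / c j) *: \sum_l io (c l) *: u l.
    by rewrite c0 scaler0 subr0.
  rewrite scaler_sumr -sumrB (bigD1_ord j)//= scalerA -scalar_of_realM.
  rewrite divfK// subrr add0r; apply: eq_bigr => l _.
  by rewrite scalerA -scalerBl -scalar_of_realM -scalar_of_realB.
have [kappa kappaE] := choice uspan.
exists N, u, (fun x => \row_l kappa x l); split=> [x|c].
  by rewrite {1}[x]kappaE; apply: eq_bigr => l _; rewrite mxE.
apply/rowP => l; rewrite mxE; apply/eqP; rewrite -subr_eq0; apply/eqP.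
set x := \sum_l _; apply: (free (fun l => kappa x l - c 0 l)).
under eq_bigr do rewrite scalar_of_realB scalerBl.
by rewrite sumrB -kappaE subrr.
Qed.

End RealBasis.

Lemma compact_box (R : realType) (n : nat) (A : set 'rV[R]_n) (B : 'I_n -> R) :
  closed A -> (forall v, A v -> forall l, `|v 0 l| <= B l) -> compact A.
Proof.
move=> Aclosed AB; apply: (subclosed_compact Aclosed
  (@rV_compact R n (fun l => `[- B l, B l]%classic) _)) => [l|v Av l /=].
  exact: segment_compact.
by rewrite in_itv/= -ler_norml; exact: AB.
Qed.

(** * Norms and norming pairs *)

Section LinearFunctions.
Variables (K : numFieldType) (U V : lmodType K) (f : U -> V).
Hypothesis flin : linear f.

Lemma linear_funD x y : f (x + y) = f x + f y.
Proof. by have := flin 1 x y; rewrite !scale1r. Qed.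

Lemma linear_fun0 : f 0 = 0.
Proof. by apply: (addrI (f 0)); rewrite -linear_funD !addr0. Qed.

Lemma linear_funZ a x : f (a *: x) = a *: f x.
Proof. by rewrite -[a *: x]addr0 flin linear_fun0 addr0. Qed.

Lemma linear_fun_sum (I : Type) (r : seq I) (g : I -> U) :
  f (\sum_(i <- r) g i) = \sum_(i <- r) f (g i).
Proof. exact: (big_morph f linear_funD linear_fun0). Qed.

End LinearFunctions.

Section NormingPairs.
Variables (R : realType) (k : scalar_kind).
Local Notation F := (scalar_field R k).
Local Notation io := (@scalar_of_real R k).
Local Notation re := (@scalar_re R k).
Local Notation abs := (@scalar_abs R k).
Variable X : completeNormedModType F.

Definition real_norm (x : X) : R := re `|x|.

Lemma real_normE x : io (real_norm x) = `|x|.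
Proof. by rewrite scalar_of_real_re// normr_real. Qed.

Lemma real_norm_ge0 x : 0 <= real_norm x.
Proof. by rewrite -(@ler_scalar_of_real R k) real_normE scalar_of_real0. Qed.

Lemma real_normZ a x : real_norm (a *: x) = abs a * real_norm x.
Proof. by rewrite /real_norm normrZ -scalar_absE scalar_reZ. Qed.

Lemma real_normD x y : real_norm (x + y) <= real_norm x + real_norm y.
Proof.
by rewrite -(@ler_scalar_of_real R k) scalar_of_realD !real_normE ler_normD.
Qed.

Lemma real_norm_eq0 x : real_norm x = 0 -> x = 0.
Proof.
by move=> x0; apply/eqP; rewrite -normr_eq0 -real_normE x0 scalar_of_real0.
Qed.

Lemma real_norm0 : real_norm 0 = 0.
Proof. by rewrite /real_norm normr0 scalar_re0. Qed.

Lemma unit_ballE x : unit_ball x <-> real_norm x <= 1.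
Proof. by rewrite /unit_ball /= -real_normE -(@scalar_of_real1 R k) ler_scalar_of_real. Qed.

Lemma unit_sphereE x : unit_sphere x <-> real_norm x = 1.
Proof.
rewrite /unit_sphere /= -real_normE -(@scalar_of_real1 R k).
by split => [/(can_inj (@scalar_reK R k))|->].
Qed.

Lemma functional_le_norm (f : X -> F^o) : linear f ->
  (forall y, real_norm y <= 1 -> abs (f y) <= 1) ->
  forall x, abs (f x) <= real_norm x.
Proof.
move=> flin f1 x.
have fZ a y : f (a *: y) = a * f y by exact: (linear_funZ flin).
have [x0|x_neq0] := eqVneq (real_norm x) 0.
  by rewrite x0 (real_norm_eq0 x0) -(scale0r x) fZ mul0r scalar_abs0.
have x_gt0 : 0 < real_norm x by rewrite lt_def x_neq0 real_norm_ge0.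
have := f1 (io (real_norm x)^-1 *: x).
rewrite fZ scalar_absM real_normZ scalar_abs_of_real ger0_norm ?invr_ge0 ?real_norm_ge0//.
by rewrite mulVf// lexx mulrC ler_pdivrMr// mul1r; apply.
Qed.

Lemma dual_ballE (f : X -> F^o) : dual_ball f <->
  bounded_linear f /\ forall x, real_norm x <= 1 -> abs (f x) <= 1.
Proof.
have nonempty : [set abs (f x) | x in @unit_ball R k X] !=set0.
  by exists (abs (f 0)), 0 => //; apply/unit_ballE; rewrite real_norm0.
split=> -[fbl f1]; split => //; last first.
  by apply: sup_le_ub => // _ [x /unit_ballE x1 <-]; exact: f1.
move=> x x1; apply: le_trans f1; apply: sup_upper_bound; last first.
  by exists x => //; apply/unit_ballE.
split => //; case: fbl => _ [M fM]; exists (Num.max (re M) 0).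
move=> _ [y /unit_ballE y1 <-].
have : abs (f y) <= re M * real_norm y.
  have /= := fM y; rewrite -scalar_absE -real_normE mulrC.
  have lere (a b : F) : a <= b -> re a <= re b.
    by case: k a b => //= -[? ?] [? ?]; rewrite lecE => /andP[].
  by move=> /lere; rewrite scalar_reK scalar_reZ mulrC.
move=> /le_trans; apply; have [M0|M0] := leP 0 (re M).
  by rewrite ler_piMr.
by rewrite mulr_le0_ge0 ?real_norm_ge0// ltW.
Qed.

(** Norms at most [1] suffice, since [f x = 1] forces both to be [1]. *)
Lemma state_pairsE (x : X) (f : X -> F^o) : state_pairs (x, f) <->
  [/\ unit_ball x, dual_ball f & f x = 1].
Proof.
split=> [[/= /unit_sphereE x1 [fbl f1] fx]|[/unit_ballE x1 fball fx]].
  by split; [apply/unit_ballE; rewrite x1|split; rewrite ?f1|].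
have /dual_ballE[[flin _] f1] := fball.
have abs_fx : abs (f x) = 1 by rewrite fx scalar_abs1.
split => //=.
  apply/unit_sphereE/eqP; rewrite eq_le x1/= -[leLHS]abs_fx.
  exact: functional_le_norm.
have [fbl dual1] := fball; split => //; apply/eqP; rewrite eq_le dual1/=.
rewrite -[leLHS]abs_fx; apply: sup_upper_bound; last first.
  by exists x => //; exact/unit_ballE.
split; first by exists (abs (f x)), x => //; exact/unit_ballE.
by exists 1 => _ [y /unit_ballE y1 <-]; exact: f1.
Qed.

End NormingPairs.

Lemma continuous_sum (K : numFieldType) (T : topologicalType)
    (V : normedModType K) (n : nat) (f : 'I_n -> T -> V) :
  (forall i, continuous (f i)) -> continuous (fun t => \sum_(i < n) f i t).
Proof.
move=> fcont; apply: continuous_big => //; exact: add_continuous.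
Qed.

(** * Coordinates on the unit balls and on the norming pairs *)

Section Coordinates.
Variables (R : realType) (k : scalar_kind).
Local Notation F := (scalar_field R k).
Local Notation io := (@scalar_of_real R k).
Local Notation re := (@scalar_re R k).
Local Notation abs := (@scalar_abs R k).
Variable X : completeNormedModType F.
Variables (N : nat) (u : 'I_N -> X) (kappa : X -> 'rV[R]_N).
Hypothesis kappaE : forall x, x = \sum_(l < N) io (kappa x 0 l) *: u l.
Hypothesis kappaK :
  forall c : 'rV[R]_N, kappa (\sum_(l < N) io (c 0 l) *: u l) = c.

Let vec (c : 'rV[R]_N) : X := \sum_(l < N) io (c 0 l) *: u l.

Let vecD c c' : vec (c + c') = vec c + vec c'.
Proof.
rewrite /vec -big_split/=; apply: eq_bigr => l _.
by rewrite mxE scalar_of_realD scalerDl.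
Qed.

Let vecZ t c : vec (t *: c) = io t *: vec c.
Proof.
rewrite /vec scaler_sumr; apply: eq_bigr => l _.
by rewrite mxE scalar_of_realM scalerA.
Qed.

Let kappaD x y : kappa (x + y) = kappa x + kappa y.
Proof. by rewrite {1}(kappaE x) {1}(kappaE y) -vecD kappaK. Qed.

Let kappaZ t x : kappa (io t *: x) = t *: kappa x.
Proof. by rewrite {1}(kappaE x) -vecZ kappaK. Qed.

(** ** The unit ball *)

Let ball := [set c | real_norm (vec c) <= 1].

Let norm_vec_continuous (T : topologicalType) (c : T -> 'rV[R]_N) :
  (forall l, continuous (fun t => c t 0 l)) ->
  continuous (fun t => real_norm (vec (c t))).
Proof.
move=> ccont t; apply: (cvg_comp (fun t => `|vec (c t)|) re); last first.
  exact: scalar_re_continuous.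
suff vec_continuous : continuous (vec \o c).
  by apply: (cvg_comp (vec \o c) Num.norm); [exact: vec_continuous|exact: norm_continuous].
apply: (@continuous_sum _ _ X) => l {}t.
apply: (continuous_comp (f := fun t => io (c t 0 l)) (g := fun a => a *: u l)).
  apply: (continuous_comp (f := fun t => c t 0 l) (g := io)).
    exact: ccont.
  exact: scalar_of_real_continuous.
exact: scalel_continuous.
Qed.

Let ball_closed : closed ball.
Proof.
apply: (@preimage_closed _ R (fun c => real_norm (vec c)) [set r | r <= 1]).
  move=> c _; apply: (norm_vec_continuous (c := id)) => l.
  exact: coord_continuous.
exact: closed_le.
Qed.

(** The norm is bounded below on the unit sphere for the coordinates, by
    compactness of that sphere. *)
Let ball_bounded : exists B : R, forall c, ball c -> forall l, `|c 0 l| <= B.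
Proof.
have coord_le (c : 'rV[R]_N) l : `|c 0 l| <= `|c|.
  rewrite [leRHS]/Num.norm /= mx_normrE.
  by apply/bigmax_geP; right; exists (0, l).
pose sphere := [set c : 'rV[R]_N | `|c| = 1].
have [[c0 sc0]|nosphere] := pselect (sphere !=set0); last first.
  exists 0 => c _ l; have [->|c_neq0] := eqVneq c 0; first by rewrite mxE normr0.
  case: nosphere; exists (`|c|^-1 *: c).
  by rewrite /sphere /= normrZ normfV normr_id mulVf// normr_eq0.
have sphere_compact : compact sphere.
  apply: (@compact_box _ _ _ (fun=> 1)); last by move=> v <- l.
  apply: (@preimage_closed _ R (fun c : 'rV[R]_N => `|c|) [set 1]).
    by move=> c _; exact: norm_continuous.
  exact: closed_eq.
have [||b] := @compact_EVT_min _ R (fun c => real_norm (vec c)) sphere _ sphere_compact.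
- by exists c0.
- apply: continuous_subspaceT; apply: (norm_vec_continuous (c := id)) => l.
  exact: coord_continuous.
rewrite inE => b1 bmin; set m := real_norm (vec b) in bmin.
have m_gt0 : 0 < m.
  rewrite lt_def real_norm_ge0 andbT; apply/eqP => /real_norm_eq0 b0.
  move: b1; rewrite /sphere /= -(kappaK b) -/(vec b) b0.
  by rewrite -(scale0r (0 : X)) -(@scalar_of_real0 R k) kappaZ scale0r normr0 => /eqP; rewrite eq_sym oner_eq0.
exists m^-1 => c c1 l; apply: le_trans (coord_le c l) _.
have [->|c_neq0] := eqVneq c 0; first by rewrite normr0 invr_ge0 ltW.
have nc_gt0 : 0 < `|c| by rewrite normr_gt0.
have : m <= real_norm (vec (`|c|^-1 *: c)).
  by apply: bmin; rewrite inE /sphere /= normrZ normfV normr_id mulVf// gt_eqF.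
rewrite vecZ real_normZ scalar_abs_of_real normfV normr_id ler_pdivlMl// => mc.
by rewrite -[leRHS]mul1r ler_pdivlMr// (le_trans mc).
Qed.

Let ball_compact : compact ball.
Proof.
have [B ballB] := ball_bounded.
exact: (compact_box (B := fun=> B) ball_closed).
Qed.

Let ball_mixture : mixture_closed ball.
Proof.
move=> c c' t c1 c'1 /andP[t0 t1]; rewrite /ball /= vecD !vecZ.
rewrite (le_trans (real_normD _ _))// !real_normZ !scalar_abs_of_real.
rewrite (gtr0_norm t0) gtr0_norm ?subr_gt0//.
rewrite [leRHS](_ : 1 = t * 1 + (1 - t) * 1); last by ring.
by apply: lerD; rewrite ler_pM2l// subr_gt0.
Qed.

(** Coordinates carry extreme points of [ball] to extreme points of the unit
    ball of [X], since a scalar between [0] and [1] is real. *)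
Lemma minkowski_unit_ball_coord (x : X) (Q : set X) :
  unit_ball x ->
  (forall y z t, Q y -> Q z -> 0 < t < 1 -> Q (io t *: y + io (1 - t) *: z)) ->
  (forall e, extreme_points (@unit_ball R k X) e ->
     (exists (z : X) (t : R), [/\ unit_ball z, 0 < t < 1 &
        x = io t *: e + io (1 - t) *: z]) -> Q e) ->
  Q x.
Proof.
move=> /unit_ballE x1 Qmix Qext; rewrite (kappaE x) -/(vec (kappa x)).
apply: (minkowski ball_compact ball_mixture (Q := [set c | Q (vec c)])).
- by rewrite /ball /= /vec -kappaE.
- by move=> c c' t Qc Qc' t01; rewrite /= vecD !vecZ; exact: Qmix.
move=> c [c1 cext] [z [t [z1 t01 xE]]]; apply: Qext; last first.
  exists (vec z), t; split => //; first exact/unit_ballE.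
  by rewrite (kappaE x) -/(vec (kappa x)) xE vecD !vecZ.
split=> [|y w s /unit_ballE y1 /unit_ballE w1 s01 cE]; first exact/unit_ballE.
have sE : s = io (re s) by rewrite scalar_of_real_re// gtr0_real//; case/andP: s01.
have s01' : 0 < re s < 1.
  by rewrite -2!(@ltr_scalar_of_real R k) -sE scalar_of_real0 scalar_of_real1.
have [yc wc] : kappa y = c /\ kappa w = c.
  apply: (cext _ _ (re s)) => //.
  - by rewrite /ball /= /vec -kappaE.
  - by rewrite /ball /= /vec -kappaE.
  - rewrite -!kappaZ -kappaD scalar_of_realB scalar_of_real1 -sE -cE.
    by rewrite kappaK.
by split; [rewrite -yc|rewrite -wc]; rewrite /vec -kappaE.
Qed.

(** ** The dual unit ball *)

Let dot (g c : 'rV[R]_N) : R := \sum_(l < N) g 0 l * c 0 l.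
(* The dual of [X] is parametrized by the real parts of functionals, which are
   arbitrary real-linear forms. *)
Let fun_of (g : 'rV[R]_N) : X -> F^o := complexify (fun x => dot g (kappa x)).
Let coord_of (f : X -> F^o) : 'rV[R]_N := \row_l re (f (u l)).

Let dotDr g c c' : dot g (c + c') = dot g c + dot g c'.
Proof. by rewrite /dot -big_split/=; apply: eq_bigr => l _; rewrite mxE mulrDr. Qed.

Let dotDl g g' c : dot (g + g') c = dot g c + dot g' c.
Proof. by rewrite /dot -big_split/=; apply: eq_bigr => l _; rewrite mxE mulrDl. Qed.

Let dotZr t g c : dot g (t *: c) = t * dot g c.
Proof. by rewrite /dot mulr_sumr; apply: eq_bigr => l _; rewrite mxE mulrCA. Qed.

Let dotZl t g c : dot (t *: g) c = t * dot g c.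
Proof. by rewrite /dot mulr_sumr; apply: eq_bigr => l _; rewrite mxE mulrA. Qed.

Let fun_of_linear g : linear (fun_of g).
Proof.
by apply: complexify_linear => [x y|t x]; rewrite (kappaD, kappaZ) (dotDr, dotZr).
Qed.

Let fun_of_re g x : re (fun_of g x) = dot g (kappa x).
Proof. exact: scalar_re_complexify. Qed.

Let dot_kappa_basis g l : dot g (kappa (u l)) = g 0 l.
Proof.
have -> : kappa (u l) = delta_mx 0 l.
  rewrite -[RHS]kappaK; congr kappa; rewrite (bigD1 l)//= mxE !eqxx/=.
  rewrite scalar_of_real1 scale1r big1 ?addr0// => j jl.
  by rewrite mxE (negbTE jl) andbF scalar_of_real0 scale0r.
rewrite /dot (bigD1 l)//= mxE !eqxx mulr1 big1 ?addr0// => j jl.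
by rewrite mxE (negbTE jl) andbF mulr0.
Qed.

Let re_coord_of (f : X -> F^o) x : linear f -> re (f x) = dot (coord_of f) (kappa x).
Proof.
move=> flin; rewrite {1}(kappaE x) linear_fun_sum// scalar_re_sum.
apply: eq_bigr => l _; rewrite linear_funZ// [_ *: _]/(_ * _) scalar_reZ mxE.
by rewrite mulrC.
Qed.

Let coord_ofK (f : X -> F^o) : linear f -> fun_of (coord_of f) = f.
Proof.
move=> flin; apply/funext => x; rewrite [RHS]scalar_decomp /fun_of /complexify.
by rewrite -!(re_coord_of _ flin) (linear_funZ flin).
Qed.

Let dual := [set g | forall c, ball c -> dot g c <= 1].

(** A functional whose real part is at most [1] on the unit ball has modulus at
    most [1] there, as the ball is invariant under phases. *)
Let dual_fun_of g : dual_ball (fun_of g) <-> dual g.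
Proof.
split=> [/dual_ballE[_ f1] c c1|g1].
  have := f1 (vec c) c1; apply: le_trans; rewrite -[leLHS](_ : re (fun_of g (vec c)) = _).
    exact: ler_scalar_re_abs.
  by rewrite fun_of_re kappaK.
have f1 x : real_norm x <= 1 -> abs (fun_of g x) <= 1.
  move=> x1; have [a a1 aE] := scalar_phase (fun_of g x).
  rewrite -[leLHS](@scalar_reK R k) -aE.
  rewrite -[a * _]/(a *: _) -(linear_funZ (fun_of_linear g)) fun_of_re; apply: g1.
  by rewrite /ball /= /vec -kappaE real_normZ a1 mul1r.
apply/dual_ballE; split => //; split; first exact: fun_of_linear.
exists 1 => x; rewrite mul1r -real_normE -scalar_absE ler_scalar_of_real.
by apply: functional_le_norm => //; exact: fun_of_linear.
Qed.

Let dual_coord_of (f : X -> F^o) : dual_ball f -> dual (coord_of f).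
Proof.
move=> fball; apply/dual_fun_of; rewrite coord_ofK//.
by case: fball => -[].
Qed.

Let dot_continuous (T : topologicalType) (g c : T -> 'rV[R]_N) :
  (forall l, continuous (fun t => g t 0 l)) ->
  (forall l, continuous (fun t => c t 0 l)) ->
  continuous (fun t => dot (g t) (c t)).
Proof.
move=> gcont ccont; apply: (@continuous_sum _ _ R^o) => l t.
by apply: (@cvgM R T (nbhs t)); [exact: gcont|exact: ccont].
Qed.

Let dual_closed : closed dual.
Proof.
rewrite (_ : dual = \bigcap_(c in ball) [set g | dot g c <= 1]); last first.
  by apply/seteqP; split.
apply: closed_bigI => c _.
apply: (@preimage_closed _ R (fun g => dot g c) [set r | r <= 1]).
  move=> g _; apply: (dot_continuous (g := id)) => l; last exact: cst_continuous.
  exact: coord_continuous.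
exact: closed_le.
Qed.

Let dual_bounded g : dual g -> forall l, `|g 0 l| <= real_norm (u l).
Proof.
move=> /dual_fun_of/dual_ballE[[flin _] f1] l.
have f1' := functional_le_norm flin f1.
have -> : g 0 l = re (fun_of g (u l)).
  by rewrite fun_of_re dot_kappa_basis.
apply: le_trans (f1' (u l)); rewrite ler_norml ler_scalar_re_abs andbT lerNl.
by rewrite -scalar_reN -scalar_absN ler_scalar_re_abs.
Qed.

Let dual_compact : compact dual.
Proof. exact: compact_box dual_closed dual_bounded. Qed.

Let dual_mixture : mixture_closed dual.
Proof.
move=> g g' t g1 g'1 /andP[t0 t1] c c1; rewrite dotDl !dotZl.
rewrite [leRHS](_ : 1 = t * 1 + (1 - t) * 1); last by ring.
by apply: lerD; rewrite ler_pM2l ?subr_gt0// (g1, g'1).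
Qed.

Let fun_ofD g g' : fun_of (g + g') = fun_of g + fun_of g'.
Proof.
apply/funext => x; rewrite -[RHS]/(fun_of g x + fun_of g' x).
by rewrite /fun_of /complexify !dotDl !scalar_of_realD; ring.
Qed.

Let fun_ofZ t g : fun_of (t *: g) = io t *: fun_of g.
Proof.
apply/funext => x; rewrite -[RHS]/(io t * fun_of g x).
by rewrite /fun_of /complexify !dotZl !scalar_of_realM; ring.
Qed.

Let coord_ofD f f' : coord_of (f + f') = coord_of f + coord_of f'.
Proof. by apply/rowP => l; rewrite !mxE -scalar_reD. Qed.

Let coord_ofZ t f : coord_of (io t *: f) = t *: coord_of f.
Proof. by apply/rowP => l; rewrite !mxE -scalar_reZ. Qed.

Let fun_ofK g : coord_of (fun_of g) = g.
Proof.
by apply/rowP => l; rewrite mxE fun_of_re dot_kappa_basis.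
Qed.

Lemma minkowski_dual_ball_coord (f : X -> F^o) (Q : set (X -> F^o)) :
  dual_ball f ->
  (forall g h t, Q g -> Q h -> 0 < t < 1 -> Q (io t *: g + io (1 - t) *: h)) ->
  (forall e, extreme_points (@dual_ball R k X) e ->
     (exists (h : X -> F^o) (t : R), [/\ dual_ball h, 0 < t < 1 &
        f = io t *: e + io (1 - t) *: h]) -> Q e) ->
  Q f.
Proof.
move=> fball Qmix Qext; have flin : linear f by case: fball => -[].
rewrite -(coord_ofK flin).
apply: (minkowski dual_compact dual_mixture (Q := [set g | Q (fun_of g)])).
- exact: dual_coord_of.
- by move=> g g' t Qg Qg' t01; rewrite /= fun_ofD !fun_ofZ; exact: Qmix.
move=> g [g1 gext] [h [t [h1 t01 fE]]]; apply: Qext; last first.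
  exists (fun_of h), t; split => //; first exact/dual_fun_of.
  by rewrite -(coord_ofK flin) fE fun_ofD !fun_ofZ.
split=> [|y w s yball wball s01 gE]; first exact/dual_fun_of.
have sE : s = io (re s) by rewrite scalar_of_real_re// gtr0_real//; case/andP: s01.
have s01' : 0 < re s < 1.
  by rewrite -2!(@ltr_scalar_of_real R k) -sE scalar_of_real0 scalar_of_real1.
have [yg wg] : coord_of y = g /\ coord_of w = g.
  apply: (gext _ _ (re s)) => //.
  - exact: dual_coord_of.
  - exact: dual_coord_of.
  - rewrite -!coord_ofZ -coord_ofD scalar_of_realB scalar_of_real1 -sE -gE.
    by rewrite fun_ofK.
split; [rewrite -yg|rewrite -wg]; rewrite coord_ofK//.
  by case: yball => -[].
by case: wball => -[].
Qed.

(** ** Norming pairs *)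

Let pair_of (z : 'rV[R]_(N + N)) : X * (X -> F^o) :=
  (vec (lsubmx z), fun_of (rsubmx z)).

Let pairs := [set z : 'rV[R]_(N + N) | [/\ ball (lsubmx z), dual (rsubmx z)
  & dot (rsubmx z) (lsubmx z) = 1]].

Let lsub_continuous l : continuous (fun z : 'rV[R]_(N + N) => lsubmx z 0 l).
Proof.
under eq_fun do rewrite mxE.
exact: coord_continuous.
Qed.

Let rsub_continuous l : continuous (fun z : 'rV[R]_(N + N) => rsubmx z 0 l).
Proof.
under eq_fun do rewrite mxE.
exact: coord_continuous.
Qed.

Let pairs_compact : compact pairs.
Proof.
have [B ballB] := ball_bounded.
apply: (compact_box (B := fun j => match fintype.split j with
  inl _ => B | inr l => real_norm (u l) end)).
- rewrite (_ : pairs = [set z | real_norm (vec (lsubmx z)) <= 1] `&`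
      (\bigcap_(c in ball) [set z | dot (rsubmx z) c <= 1]) `&`
      [set z | dot (rsubmx z) (lsubmx z) = 1]); last first.
    by apply/seteqP; split => z; [move=> [? ? ?]|move=> [[? ?] ?]].
  apply: closedI; first apply: closedI.
  + apply: (@preimage_closed _ R (fun z => real_norm (vec (lsubmx z))) [set r | r <= 1]).
      by move=> z _; apply: norm_vec_continuous.
    exact: closed_le.
  + apply: closed_bigI => c _.
    apply: (@preimage_closed _ R (fun z => dot (rsubmx z) c) [set r | r <= 1]).
      by move=> z _; apply: dot_continuous => // l; exact: cst_continuous.
    exact: closed_le.
  + apply: (@preimage_closed _ R (fun z => dot (rsubmx z) (lsubmx z)) [set 1]).
      by move=> z _; apply: dot_continuous.
    exact: closed_eq.
- move=> z [zball zdual _] j; case: (fintype.splitP j) => l jl.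
    by have := ballB _ zball l; rewrite mxE; congr (`|z _ _| <= _); exact/val_inj.
  by have := dual_bounded zdual l; rewrite mxE; congr (`|z _ _| <= _); exact/val_inj.
Qed.

Let pairs_state z : pairs z -> state_pairs (pair_of z).
Proof.
move=> [x1 /dual_fun_of fball zx]; apply/state_pairsE; split => //.
  exact/unit_ballE.
have /dual_ballE[_ f1] := fball.
by apply: scalar_eq1; [exact: f1|rewrite fun_of_re kappaK].
Qed.

Let pairs_onto x f : state_pairs (x, f) -> exists2 z, pairs z & pair_of z = (x, f).
Proof.
move=> /state_pairsE[/unit_ballE x1 fball fx]; have flin : linear f by case: fball => -[].
exists (row_mx (kappa x) (coord_of f)); last first.
  by rewrite /pair_of row_mxKl row_mxKr /vec -kappaE coord_ofK.
rewrite /pairs /= row_mxKl row_mxKr; split.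
- by rewrite /ball /= /vec -kappaE.
- exact: dual_coord_of.
- by rewrite -re_coord_of// fx -(@scalar_of_real1 R k) scalar_reK.
Qed.

Let pair_of_continuous (A : X -> X) : linear A ->
  continuous (fun z => (pair_of z).2 (A (pair_of z).1) : F).
Proof.
move=> Alin.
have -> : (fun z => (pair_of z).2 (A (pair_of z).1) : F) =
    (fun z => \sum_l io (lsubmx z 0 l) * (fun_of (rsubmx z) (A (u l)))).
  apply/funext => z; rewrite /pair_of /= linear_fun_sum//.
  rewrite (linear_fun_sum (fun_of_linear _)); apply: eq_bigr => l _.
  by rewrite (linear_funZ Alin) (linear_funZ (fun_of_linear _)).
apply: (@continuous_sum _ _ F^o) => l z; apply: (@cvgM F _ (nbhs z)).
  apply: (continuous_comp (f := fun z => lsubmx z 0 l) (g := io)).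
    exact: lsub_continuous.
  exact: scalar_of_real_continuous.
have io_dot v : continuous (fun z : 'rV[R]_(N + N) => io (dot (rsubmx z) (kappa v))).
  move=> {}z; apply: (continuous_comp (f := fun z => dot (rsubmx z) (kappa v)) (g := io)).
    by apply: dot_continuous => // j; exact: cst_continuous.
  exact: scalar_of_real_continuous.
apply: (@cvgB F F^o _ (nbhs z)); first exact: io_dot.
by apply: (@cvgMl_tmp F _ (nbhs z)); exact: io_dot.
Qed.

Lemma compact_state_pairs_coord :
  exists (W : ptopologicalType) (P : set W) (pr : W -> X * (X -> F^o)),
    [/\ compact P,
        forall w, P w -> state_pairs (pr w),
        forall xf, state_pairs xf -> exists2 w, P w & pr w = xf
      & forall A : X -> X, linear A ->
          continuous (fun w => (pr w).2 (A (pr w).1) : F)].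
Proof.
exists 'rV[R]_(N + N), pairs, pair_of.
split; [exact: pairs_compact|exact: pairs_state| |exact: pair_of_continuous].
by move=> [x f]; exact: pairs_onto.
Qed.

End Coordinates.

Section FiniteDimension.
Variables (R : realType) (k : scalar_kind).
Local Notation F := (scalar_field R k).
Local Notation io := (@scalar_of_real R k).
Variable X : completeNormedModType F.
Hypothesis X_fin : finite_dim X.

Lemma minkowski_unit_ball (x : X) (Q : set X) :
  unit_ball x ->
  (forall y z t, Q y -> Q z -> 0 < t < 1 -> Q (io t *: y + io (1 - t) *: z)) ->
  (forall e, extreme_points (@unit_ball R k X) e ->
     (exists (z : X) (t : R), [/\ unit_ball z, 0 < t < 1 &
        x = io t *: e + io (1 - t) *: z]) -> Q e) ->
  Q x.
Proof.
have [N [u [kappa [kappaE kappaK]]]] := exists_real_basis X_fin.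
exact: (@minkowski_unit_ball_coord R k X N u kappa kappaE kappaK x Q).
Qed.

Lemma minkowski_dual_ball (f : X -> F^o) (Q : set (X -> F^o)) :
  dual_ball f ->
  (forall g h t, Q g -> Q h -> 0 < t < 1 -> Q (io t *: g + io (1 - t) *: h)) ->
  (forall e, extreme_points (@dual_ball R k X) e ->
     (exists (h : X -> F^o) (t : R), [/\ dual_ball h, 0 < t < 1 &
        f = io t *: e + io (1 - t) *: h]) -> Q e) ->
  Q f.
Proof.
have [N [u [kappa [kappaE kappaK]]]] := exists_real_basis X_fin.
exact: (@minkowski_dual_ball_coord R k X N u kappa kappaE kappaK f Q).
Qed.

(** Compactness of the set of norming pairs, in a form that spares a topology
    on functionals: the pairs are the image of a compact set along which the
    values at the pairs vary continuously. *)
Lemma compact_state_pairs :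
  exists (W : ptopologicalType) (P : set W) (pr : W -> X * (X -> F^o)),
    [/\ compact P,
        forall w, P w -> state_pairs (pr w),
        forall xf, state_pairs xf -> exists2 w, P w & pr w = xf
      & forall A : X -> X, linear A ->
          continuous (fun w => (pr w).2 (A (pr w).1) : F)].
Proof.
have [N [u [kappa [kappaE kappaK]]]] := exists_real_basis X_fin.
exact: (@compact_state_pairs_coord R k X N u kappa kappaE kappaK).
Qed.

End FiniteDimension.

(** * The joint numerical radius *)

(** Strict convexity of the [p]-norm of [F^d]: averaging the tangent
    inequalities at [a] towards [a'] and [a''] leaves no room for a strict one. *)
Lemma sum_powR_rigid (R : realType) (k : scalar_kind) (p : R) (d : nat)
    (a a' a'' : 'I_d -> scalar_field R k) (t : R) :
  1 < p -> 0 < t < 1 ->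
  (forall i, a i = scalar_of_real k t * a' i + scalar_of_real k (1 - t) * a'' i) ->
  \sum_i scalar_abs (a' i) `^ p <= \sum_i scalar_abs (a i) `^ p ->
  \sum_i scalar_abs (a'' i) `^ p <= \sum_i scalar_abs (a i) `^ p ->
  forall i, a' i = a i.
Proof.
move=> p1 /andP[t0 t1] aE le' le'' i0; apply: contrapT => /eqP a'0.
pose g (b : 'I_d -> scalar_field R k) :=
  \sum_i p * scalar_re (conj_pow p (a i) * (b i - a i)).
have tangent' : \sum_i scalar_abs (a i) `^ p + g a' < \sum_i scalar_abs (a' i) `^ p.
  rewrite -big_split/= (bigD1 i0)//= [ltRHS](bigD1 i0)//=.
  apply: ltr_leD; first by apply: tangent_lt => //; rewrite eq_sym.
  by apply: ler_sum => i _; exact: tangent_le.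
have tangent'' : \sum_i scalar_abs (a i) `^ p + g a'' <= \sum_i scalar_abs (a'' i) `^ p.
  by rewrite -big_split/=; apply: ler_sum => i _; exact: tangent_le.
have balance : t * g a' + (1 - t) * g a'' = 0.
  rewrite !mulr_sumr -big_split/= big1// => i _.
  rewrite !(mulrCA _ p) -mulrDr -!scalar_reZ -scalar_reD.
  rewrite [X in scalar_re X](_ : _ = 0) ?scalar_re0 ?mulr0//.
  by rewrite {2 4}aE scalar_of_realB scalar_of_real1; ring.
nra.
Qed.

Lemma ler_powR_base (R : realType) (p a b : R) : 0 < p -> 0 <= a -> 0 <= b ->
  (a `^ p <= b `^ p) = (a <= b).
Proof.
move=> p0 a0 b0; have [ab|ba] := leP a b; first by rewrite ge0_ler_powR// ltW.
by apply/negbTE; rewrite -ltNge gt0_ltr_powR.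
Qed.

Section JointRadius.
Variables (R : realType) (k : scalar_kind).
Local Notation F := (scalar_field R k).
Local Notation io := (@scalar_of_real R k).
Local Notation re := (@scalar_re R k).
Local Notation abs := (@scalar_abs R k).
Local Notation im := (scalar_im_unit R k).
Variable X : completeNormedModType F.
Hypothesis X_fin : finite_dim X.
Variables (d : nat) (p : R).
Hypothesis p_gt1 : 1 < p.
Implicit Types (T S : 'I_d -> X -> X) (xf : X * (X -> F^o)).

Let p_gt0 : 0 < p. Proof. exact: lt_trans ltr01 p_gt1. Qed.

(** Without the outer root of [joint_value], so that tangents can be taken term
    by term. *)
Definition joint_power T xf : R := \sum_(i < d) abs (xf.2 (T i xf.1)) `^ p.
Local Notation power := joint_power.

Let joint_valueE T xf : joint_value p T xf = power T xf `^ p^-1.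
Proof. by []. Qed.

Let power_ge0 T xf : 0 <= power T xf.
Proof. by apply: sumr_ge0 => i _; exact: powR_ge0. Qed.

Let power_root T xf : (power T xf `^ p^-1) `^ p = power T xf.
Proof. by rewrite -powRrM mulVf ?gt_eqF// powRr1. Qed.

Let root_le T xf xf' : power T xf <= power T xf' ->
  power T xf `^ p^-1 <= power T xf' `^ p^-1.
Proof.
by move=> le; apply: ge0_ler_powR; rewrite ?nnegrE ?power_ge0// invr_ge0 ltW.
Qed.

(** The zero radius of an empty set of norming pairs would make the identity
    vanish. *)
Lemma state_pairs_nonempty : (exists x : X, x != 0) -> num_radius_is_norm X ->
  @state_pairs R k X !=set0.
Proof.
move=> [x x0] [_ w_eq0 _ _]; apply: contrapT => nopair.
have id_bl : bounded_linear (id : X -> X).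
  by split => //; exists 1 => y; rewrite mul1r.
suff /(w_eq0 _ id_bl)/(congr1 (@^~ x))/= : num_radius (id : X -> X) = 0.
  by move/eqP; rewrite (negbTE x0).
rewrite /num_radius (_ : [set _ | _ in _] = set0) ?sup0//.
by apply/seteqP; split => // y [xf xfP _]; apply: nopair; exists xf.
Qed.

Hypothesis nonempty : @state_pairs R k X !=set0.

Lemma joint_power_max T : (forall i, linear (T i)) ->
  [/\ 0 <= joint_num_radius p T,
      exists2 xf, state_pairs xf & power T xf = joint_num_radius p T `^ p
    & forall xf, state_pairs xf -> power T xf <= joint_num_radius p T `^ p].
Proof.
move=> Tlin; have [W [P [pr [Pcompact Ppr prP cont]]]] := compact_state_pairs X_fin.
have P0 : P !=set0 by have [xf /prP[w Pw _]] := nonempty; exists w.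
have [|w0] := @compact_EVT_max _ R (power T \o pr) P P0 Pcompact.
  apply: continuous_subspaceT; apply: (@continuous_sum _ _ R^o) => i w.
  apply: (continuous_comp (f := fun w => (pr w).2 (T i (pr w).1) : F)
    (g := fun a : F => abs a `^ p)); first exact: cont.
  exact: scalar_abs_powR_continuous.
rewrite inE => Pw0 w0max.
have le0 xf : state_pairs xf -> power T xf <= power T (pr w0).
  by move=> /prP[w Pw <-]; apply: w0max; rewrite inE.
have wE : joint_num_radius p T = power T (pr w0) `^ p^-1.
  apply/eqP; rewrite eq_le; apply/andP; split.
    apply: ge_sup; first by exists (joint_value p T (pr w0)), (pr w0) => //; exact: Ppr.
    move=> _ [xf /le0 xfle <-]; rewrite joint_valueE.
    exact: root_le.
  apply: sup_upper_bound; last by exists (pr w0) => //; exact: Ppr.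
  split; first by exists (joint_value p T (pr w0)), (pr w0) => //; exact: Ppr.
  exists (power T (pr w0) `^ p^-1) => _ [xf /le0 xfle <-]; rewrite joint_valueE.
  exact: root_le.
by rewrite wE power_root powR_ge0; split => //; exists (pr w0) => //; exact: Ppr.
Qed.

Lemma joint_num_radius_ge0 T : (forall i, linear (T i)) ->
  0 <= joint_num_radius p T.
Proof.
by move=> Tlin; have [] := joint_power_max Tlin.
Qed.

Lemma joint_attainE T xf : (forall i, linear (T i)) ->
  joint_attain p T xf <->
  state_pairs xf /\ power T xf = joint_num_radius p T `^ p.
Proof.
move=> Tlin; split=> -[xfP xfE]; split => //.
  by rewrite -xfE joint_valueE power_root.
rewrite joint_valueE xfE -powRrM divff ?gt_eqF// powRr1//.
exact: joint_num_radius_ge0.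
Qed.

Lemma joint_num_radius_powR_le T T' :
  (forall i, linear (T i)) -> (forall i, linear (T' i)) ->
  (joint_num_radius p T <= joint_num_radius p T') <->
  (joint_num_radius p T `^ p <= joint_num_radius p T' `^ p).
Proof.
move=> Tlin T'lin.
have w0 := joint_num_radius_ge0 Tlin; have w'0 := joint_num_radius_ge0 T'lin.
by rewrite ler_powR_base.
Qed.

Lemma perturbation_linear T S (lam : 'I_d -> F) :
  (forall i, linear (T i)) -> (forall i, linear (S i)) ->
  forall i, linear ((T + tuple_scale lam S) i).
Proof.
move=> Tlin Slin i a x y.
rewrite -[LHS]/(T i (a *: x + y) + lam i *: S i (a *: x + y)).
rewrite Tlin Slin !scalerDr !scalerA [lam i * a]mulrC -scalerA addrACA.
by rewrite -scalerDr.
Qed.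

Lemma perturbation_value T S (lam : 'I_d -> F) xf i : state_pairs xf ->
  xf.2 ((T + tuple_scale lam S) i xf.1) =
  xf.2 (T i xf.1) + lam i * xf.2 (S i xf.1).
Proof.
move=> [_ [[flin _] _] _]; transitivity (xf.2 (T i xf.1 + lam i *: S i xf.1)) => //.
by rewrite (linear_funD flin) (linear_funZ flin).
Qed.

End JointRadius.

Section Orthogonality.
Variables (R : realType) (k : scalar_kind).
Local Notation F := (scalar_field R k).
Local Notation io := (@scalar_of_real R k).
Local Notation re := (@scalar_re R k).
Local Notation abs := (@scalar_abs R k).
Local Notation im := (scalar_im_unit R k).
Variable X : completeNormedModType F.
Hypothesis X_fin : finite_dim X.
Hypothesis nonempty : @state_pairs R k X !=set0.
Variables (d : nat) (p : R).
Hypothesis p_gt1 : 1 < p.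
Variables T S : 'I_d -> X -> X.
Hypotheses (Tlin : forall i, linear (T i)) (Slin : forall i, linear (S i)).
Implicit Types (xf : X * (X -> F^o)) (lam : 'I_d -> F).

Local Notation w := (joint_num_radius p).
Local Notation power := (joint_power p).
Local Notation a := (fun xf i => xf.2 (T i xf.1) : F).
Local Notation b := (fun xf i => xf.2 (S i xf.1) : F).

Let lin lam : forall i, linear ((T + tuple_scale lam S) i) :=
  perturbation_linear lam Tlin Slin.

Let power_perturbation lam xf : state_pairs xf ->
  power (T + tuple_scale lam S) xf = \sum_i abs (a xf i + lam i * b xf i) `^ p.
Proof.
move=> xfP; apply: eq_bigr => i _.
by rewrite (perturbation_value _ _ _ _ xfP).
Qed.

(** ** Balance implies minimality *)

(** Averaging the tangent inequalities at the pairs [(x j, f j)] cancels their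
    first-order terms. *)
Lemma radius_ge_of_balance (n : nat) (t : 'I_n -> R) (x : 'I_n -> X)
    (f : 'I_n -> X -> F^o) :
  (forall j, 0 < t j) -> \sum_(j < n) t j = 1 ->
  (forall j, joint_attain p T (x j, f j)) ->
  (forall i, \sum_(j < n) io (t j) * conj_pow p (f j (T i (x j)))
               * f j (S i (x j)) = 0) ->
  forall lam, w T <= w (T + tuple_scale lam S).
Proof.
move=> t_gt0 t1 att bal lam; apply/(joint_num_radius_powR_le X_fin p_gt1 nonempty Tlin (lin lam)).
have attE j := (joint_attainE X_fin p_gt1 nonempty (x j, f j) Tlin).1 (att j).
have [_ _ le_w] := joint_power_max X_fin p_gt1 nonempty (lin lam).
have wE : \sum_j t j * power T (x j, f j) = w T `^ p.
  rewrite (eq_bigr (fun j => t j * w T `^ p)); last by move=> j _; rewrite (attE j).2.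
  by rewrite -mulr_suml t1 mul1r.
suff : \sum_j t j * power T (x j, f j) <=
    \sum_j t j * w (T + tuple_scale lam S) `^ p.
  by rewrite -mulr_suml t1 mul1r wE.
have balance : \sum_j t j * \sum_i re (conj_pow p (a (x j, f j) i) *
    (lam i * b (x j, f j) i)) = 0.
  under eq_bigr do rewrite mulr_sumr.
  rewrite exchange_big/= big1// => i _.
  transitivity (re (lam i * \sum_j io (t j) * conj_pow p (f j (T i (x j))) * f j (S i (x j)))).
    rewrite mulr_sumr scalar_re_sum; apply: eq_bigr => j _.
    by rewrite -scalar_reZ; congr re => /=; ring.
  by rewrite bal mulr0 scalar_re0.
rewrite -[leLHS]addr0 -[X in _ + X](mulr0 p) -[X in _ + p * X]balance.
rewrite [X in _ + X]mulr_sumr -big_split/=.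
apply: ler_sum => j _; rewrite mulrCA -mulrDr ler_pM2l//.
apply: le_trans (le_w _ (attE j).1).
rewrite (power_perturbation _ (attE j).1) mulr_sumr -big_split/=.
apply: ler_sum => i _.
have := tangent_le p_gt1 (a (x j, f j) i) (a (x j, f j) i + lam i * b (x j, f j) i).
by rewrite addrAC subrr add0r.
Qed.

(** ** Minimality implies a nonnegative derivative at some attaining pair *)

(** For [0 < s <= 1] the power at [T + s * lam * S] reaches [w T `^ p] at some
    pair, where the derivative along [lam] is nonnegative by convexity, the
    value at [s = 0] being no larger. The set of the [s] in [[0, 1]] that admit
    such a pair is the projection of a compact set, hence contains [0] too. *)
Lemma exists_nonneg_derivative lam :
  (forall lam, w T <= w (T + tuple_scale lam S)) ->
  exists xf, joint_attain p T xf /\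
    0 <= \sum_i re (conj_pow p (a xf i) * (lam i * b xf i)).
Proof.
move=> min_w.
have [W [P [pr [Pcompact Ppr prP cont]]]] := compact_state_pairs X_fin.
pose c (z : R * W) i : F := a (pr z.2) i + io z.1 * (lam i * b (pr z.2) i).
pose H z := \sum_i abs (c z i) `^ p.
pose D z := \sum_i re (conj_pow p (c z i) * (lam i * b (pr z.2) i)).
have a_cont i : continuous (fun z : R * W => a (pr z.2) i).
  move=> z; apply: (continuous_comp (f := snd) (g := fun v => a (pr v) i)).
    exact: cvg_snd.
  exact: cont.
have lb_cont i : continuous (fun z : R * W => lam i * b (pr z.2) i).
  move=> z; apply: (@cvgMl_tmp F _ (nbhs z)).
  apply: (cvg_comp snd (fun v => b (pr v) i)); first exact: cvg_snd.
  exact: cont.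
have c_cont i : continuous (c ^~ i).
  move=> z; apply: (@cvgD F F^o _ (nbhs z)); first exact: a_cont.
  apply: (@cvgM F _ (nbhs z)); last exact: lb_cont.
  apply: (cvg_comp fst io); first exact: cvg_fst.
  exact: scalar_of_real_continuous.
have H_cont : continuous H.
  apply: (@continuous_sum _ _ R^o) => i z.
  apply: (continuous_comp (f := c ^~ i) (g := fun r : F => abs r `^ p)).
    exact: c_cont.
  exact: scalar_abs_powR_continuous.
have D_cont : continuous D.
  apply: (@continuous_sum _ _ R^o) => i z.
  apply: (continuous_comp (g := re)
    (f := fun z => conj_pow p (c z i) * (lam i * b (pr z.2) i))).
    apply: (@cvgM F _ (nbhs z)); last exact: lb_cont.
    apply: (cvg_comp (c ^~ i) (conj_pow p)); first exact: c_cont.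
    exact: conj_pow_continuous.
  exact: scalar_re_continuous.
pose B := (`[0, 1]%classic `*` P) `&`
  ([set z | w T `^ p <= H z] `&` [set z | 0 <= D z]).
have Bcompact : compact B.
  apply: compact_closedI.
    by apply: compact_setX => //; exact: segment_compact.
  apply: closedI.
    apply: (@preimage_closed _ R H [set r | w T `^ p <= r]); last exact: closed_ge.
    by move=> z _; exact: H_cont.
  apply: (@preimage_closed _ R D [set r | 0 <= r]); last exact: closed_ge.
  by move=> z _; exact: D_cont.
have [w_ge0 _ le_w] := joint_power_max X_fin p_gt1 nonempty Tlin.
have Bpos s : 0 < s <= 1 -> (fst @` B) s.
  move=> /andP[s0 s1]; pose lam' i := io s * lam i.
  have [_ [xf xfP xfE] _] := joint_power_max X_fin p_gt1 nonempty (lin lam').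
  have [v Pv prv] := prP _ xfP.
  exists (s, v) => //; split; first by split => //=; rewrite in_itv/= ltW.
  have HE : H (s, v) = w (T + tuple_scale lam' S) `^ p.
    rewrite -xfE power_perturbation// -prv /H; apply: eq_bigr => i _.
    by rewrite /c /lam' /= mulrA.
  have Hw : w T `^ p <= H (s, v).
    rewrite HE; apply/(joint_num_radius_powR_le X_fin p_gt1 nonempty Tlin (lin lam')).
    exact: min_w.
  split => //=.
  have : H (s, v) + p * - (s * D (s, v)) <= power T xf.
    rewrite mulr_sumr -sumrN mulr_sumr -big_split/=; apply: ler_sum => i _.
    apply: le_trans (tangent_le p_gt1 (c (s, v) i) _); rewrite lerD2l.
    rewrite ler_pM2l ?(lt_trans ltr01)//.
    rewrite -scalar_reZ -scalar_reN /c -prv/= opprD addrA subrr sub0r.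
    by rewrite mulrN mulrCA.
  move=> /le_trans/(_ (le_w _ xfP))/le_trans/(_ Hw).
  rewrite gerDl pmulr_rle0 ?(lt_trans ltr01)// oppr_le0 pmulr_rge0//.
have : closed (fst @` B).
  apply: compact_closed; first exact: Rhausdorff.
  apply: continuous_compact => //; apply: continuous_subspaceT => z.
  exact: cvg_fst.
move=> /(_ 0)[|[s v] [[_ Pv] [/= Hw D0]] /= s0].
  move=> U /nbhs_ballP[e /= e0 eU]; exists (Num.min 1 (e / 2)); split.
    by apply: Bpos; rewrite lt_min ge_min lexx ltr01 divr_gt0.
  apply: eU; rewrite /ball /= sub0r normrN ger0_norm; last first.
    by rewrite le_min ler01 divr_ge0// ltW.
  by rewrite gt_min; apply/orP; right; rewrite ltr_pdivrMr// ltr_pMr// ltr1n.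
subst s.
have cE i : c (0, v) i = a (pr v) i by rewrite /c /= scalar_of_real0 mul0r addr0.
exists (pr v); split; last first.
  by apply: le_trans D0 _; apply: ler_sum => i _; rewrite cE.
apply/(joint_attainE X_fin p_gt1 nonempty _ Tlin); split; first exact: Ppr.
apply/eqP; rewrite eq_le; apply/andP; split; first exact/le_w/Ppr.
apply: le_trans Hw _; by apply: ler_sum => i _; rewrite cE.
Qed.

(** ** Passing to extreme points *)

(** With the weights [alpha] fixed, this vector of real and imaginary parts is
    real-linear in [xf.1] and in [xf.2] separately, hence compatible with
    mixtures of either. *)
Let weighted_values (alpha : 'I_d -> F) xf : 'rV[R]_(d + d) :=
  \row_l match fintype.split l with
         | inl i => re (alpha i * b xf i)
         | inr i => re (im * (alpha i * b xf i))
         end.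

Let values xf := weighted_values (fun i => conj_pow p (a xf i)) xf.

Let extreme_attaining : set (X * (X -> F^o)) := [set xf |
  [/\ extreme_points (@unit_ball R k X) xf.1,
      extreme_points (@dual_ball R k X) xf.2 & joint_attain p T xf]].

Let attain_rigid xf xf' (y : 'I_d -> F) t :
  joint_attain p T xf -> state_pairs xf' -> 0 < t < 1 ->
  \sum_i abs (y i) `^ p <= w T `^ p ->
  (forall i, a xf i = io t * a xf' i + io (1 - t) * y i) ->
  joint_attain p T xf' /\ forall i, a xf' i = a xf i.
Proof.
move=> /(joint_attainE X_fin p_gt1 nonempty _ Tlin)[xfP xfE] xf'P t01 yle aE.
have [_ _ le_w] := joint_power_max X_fin p_gt1 nonempty Tlin.
have aeq : forall i, a xf' i = a xf i.
  apply: (sum_powR_rigid p_gt1 t01 aE).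
    by rewrite -/(power T xf') -/(power T xf) xfE le_w.
  by rewrite -/(power T xf) xfE.
split => //; apply/(joint_attainE X_fin p_gt1 nonempty _ Tlin); split => //.
by rewrite -xfE; apply: eq_bigr => i _; rewrite aeq.
Qed.

(** An attaining pair [(x, f)] may be split into extreme ones. If [x] is a
    mixture of [e] and [z] in the unit ball, then [(e, f)] and [(z, f)] are
    norming pairs, and the [p]-norm being strictly convex, they attain the
    radius with the same values [f (T i e) = f (T i x)]: the weights do not
    change, and the vector of weighted values is a mixture. Minkowski's theorem
    thus makes [x] extreme, and then [f] in the same way. *)
Lemma attaining_values_extreme xf : joint_attain p T xf ->
  combinations extreme_attaining values (values xf).
Proof.
case: xf => x f att; pose alpha i := conj_pow p (a (x, f) i).
have [_ _ le_w] := joint_power_max X_fin p_gt1 nonempty Tlin.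
have /(joint_attainE X_fin p_gt1 nonempty _ Tlin)[/state_pairsE[xball fball fx] _] := att.
have [[flin _] _] := fball.
have /dual_ballE[_ f1] := fball.
rewrite -[values (x, f)]/(weighted_values alpha (x, f)).
pose Q := combinations extreme_attaining values.
have Qmix : mixture_closed Q := @combinations_mixture_closed _ _ _ _ _.
apply: (@minkowski_unit_ball R k X X_fin x (fun y => Q (weighted_values alpha (y, f)))) => //.
  move=> y z t Qy Qz t01.
  suff -> : weighted_values alpha (io t *: y + io (1 - t) *: z, f) =
    t *: weighted_values alpha (y, f) + (1 - t) *: weighted_values alpha (z, f).
    exact: Qmix.
  apply/rowP => l; rewrite !mxE; case: fintype.split => i /=;
    rewrite (linear_funD (Slin i)) !(linear_funZ (Slin i)) (linear_funD flin) !(linear_funZ flin);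
    by rewrite -!scalar_reZ -scalar_reD; congr re; rewrite /GRing.scale /=; ring.
move=> e eext [z [t [zball t01 xE]]].
have [eball _] := eext.
have [fe fz] : f e = 1 /\ f z = 1.
  apply: (scalar_mixture_eq1 _ _ t01); [exact/f1/unit_ballE|exact/f1/unit_ballE|].
  by rewrite -fx xE (linear_funD flin) !(linear_funZ flin).
have efP : state_pairs (e, f) by apply/state_pairsE.
have [eatt aeq] : joint_attain p T (e, f) /\ forall i, a (e, f) i = a (x, f) i.
  apply: (attain_rigid (y := a (z, f)) att efP t01).
    by apply: le_w; apply/state_pairsE.
  move=> i; rewrite /= xE (linear_funD (Tlin i)) !(linear_funZ (Tlin i)).
  by rewrite (linear_funD flin) !(linear_funZ flin).
apply: (@minkowski_dual_ball R k X X_fin f (fun g => Q (weighted_values alpha (e, g)))) => //.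
  move=> g h s Qg Qh s01.
  suff -> : weighted_values alpha (e, io s *: g + io (1 - s) *: h) =
    s *: weighted_values alpha (e, g) + (1 - s) *: weighted_values alpha (e, h).
    exact: Qmix.
  apply/rowP => l; rewrite !mxE; case: fintype.split => i /=;
    rewrite -[(_ + _ : X -> F^o) _]/(io s * g (S i e) + io (1 - s) * h (S i e));
    by rewrite -!scalar_reZ -scalar_reD; congr re; ring.
move=> g gext [h [s [hball s01 fE]]].
have [gball _] := gext.
have fEx y : f y = io s * g y + io (1 - s) * h y by rewrite fE.
have [ge he] : g e = 1 /\ h e = 1.
  apply: (scalar_mixture_eq1 _ _ s01); last by rewrite -fEx.
    by have /dual_ballE[_ ->//] := gball; exact/unit_ballE.
  by have /dual_ballE[_ ->//] := hball; exact/unit_ballE.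
have egP : state_pairs (e, g) by apply/state_pairsE.
have [gatt aeq'] : joint_attain p T (e, g) /\ forall i, a (e, g) i = a (e, f) i.
  apply: (attain_rigid (y := a (e, h)) eatt egP s01).
    by apply: le_w; apply/state_pairsE.
  by move=> i; rewrite /= fEx.
suff -> : weighted_values alpha (e, g) = values (e, g).
  by apply: combinations_sub; split.
apply/rowP => l; rewrite !mxE; case: fintype.split => i;
  by rewrite /alpha -[a (x, f) i]aeq -aeq'.
Qed.

(** ** Minimality implies balance *)

(** The alternative of [separation_or_balance] is applied to the vectors of the
    attaining pairs: a separating vector would be a direction of descent, against
    [exists_nonneg_derivative]. *)
Lemma balance_of_radius_ge :
  (forall lam, w T <= w (T + tuple_scale lam S)) ->
  exists (n : nat) (t : 'I_n -> R) (x : 'I_n -> X) (f : 'I_n -> X -> F^o),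
    [/\ forall j, 0 < t j,
        forall j, extreme_points (@unit_ball R k X) (x j),
        forall j, extreme_points (@dual_ball R k X) (f j),
        \sum_(j < n) t j = 1
      & (forall j, joint_attain p T (x j, f j)) /\
        forall i : 'I_d,
          \sum_(j < n) io (t j) * conj_pow p (f j (T i (x j)))
                       * f j (S i (x j)) = 0].
Proof.
move=> min_w.
have [W [P [pr [Pcompact Ppr prP cont]]]] := compact_state_pairs X_fin.
have [_ _ le_w] := joint_power_max X_fin p_gt1 nonempty Tlin.
pose M := P `&` [set v | w T `^ p <= power T (pr v)].
have Matt v : M v -> joint_attain p T (pr v).
  move=> [Pv /= le]; apply/(joint_attainE X_fin p_gt1 nonempty _ Tlin); split; first exact: Ppr.
  by apply/eqP; rewrite eq_le le andbT; exact/le_w/Ppr.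
have Mcompact : compact M.
  apply: compact_closedI => //.
  apply: (@preimage_closed _ R (power T \o pr) [set r | w T `^ p <= r]); last first.
    exact: closed_ge.
  move=> v _; apply: (@continuous_sum _ _ R^o) => i {}v.
  apply: (continuous_comp (f := fun v => a (pr v) i) (g := fun r : F => abs r `^ p)).
    exact: cont.
  exact: scalar_abs_powR_continuous.
have alphab_cont i : continuous (fun v => conj_pow p (a (pr v) i) * b (pr v) i).
  move=> v; apply: (@cvgM F _ (nbhs v)); last exact: cont.
  apply: (cvg_comp (fun v => a (pr v) i) (conj_pow p)); first exact: cont.
  exact: conj_pow_continuous.
have values_cont l : continuous (fun v => values (pr v) 0 l).
  under eq_fun do rewrite mxE.
  case: fintype.split => i v.
    apply: (continuous_comp (g := re)
      (f := fun v => conj_pow p (a (pr v) i) * b (pr v) i)).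
      exact: alphab_cont.
    exact: scalar_re_continuous.
  apply: (continuous_comp (g := re)
    (f := fun v => im * (conj_pow p (a (pr v) i) * b (pr v) i))).
    by apply: (@cvgMl_tmp F _ (nbhs v)); exact: alphab_cont.
  exact: scalar_re_continuous.
have [[u usep]|/(_ _ (@combinations_mixture_closed _ _ _ extreme_attaining values))] :=
    separation_or_balance Mcompact values_cont.
  (* Along this [lam] the derivative at a pair is minus the inner product of [u]
     with the vector of the pair. *)
  pose lam i : F := - (io (u 0 (lshift d i)) + io (u 0 (rshift d i)) * im).
  have [xf [att]] := exists_nonneg_derivative lam min_w.
  have /(joint_attainE X_fin p_gt1 nonempty _ Tlin)[xfP xfE] := att.
  have [v Pv prv] := prP _ xfP.
  have Mv : M v by split => //=; rewrite prv xfE.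
  rewrite leNgt => /negP[]; have := usep v Mv; rewrite prv big_split_ord/=.
  rewrite -big_split/= -oppr_lt0 -sumrN; apply: le_lt_trans.
  apply: ler_sum => i _; rewrite !mxE (unsplitK (inl i)) (unsplitK (inr i)).
  rewrite -!scalar_reZ -scalar_reD -scalar_reN le_eqVlt; apply/orP; left.
  by apply/eqP; congr re; rewrite /lam; ring.
move=> /(_ (fun v Mv => attaining_values_extreme (Matt v Mv))).
move=> [n [t [xf [t_gt0 t1 xfE zeroE]]]].
exists n, t, (fun j => (xf j).1), (fun j => (xf j).2); split => //.
- by move=> j; have [] := xfE j.
- by move=> j; have [] := xfE j.
split=> [j|i].
  by rewrite -surjective_pairing; have [] := xfE j.
rewrite [LHS]scalar_decomp.
have re0 : re (\sum_j io (t j) * conj_pow p (a (xf j) i) * b (xf j) i) = 0.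
  rewrite scalar_re_sum; move/rowP/(_ (lshift d i)): zeroE.
  rewrite mxE summxE => {2}->; apply: eq_bigr => j _.
  by rewrite -mulrA scalar_reZ !mxE (unsplitK (inl i)).
have im0 : re (im * \sum_j io (t j) * conj_pow p (a (xf j) i) * b (xf j) i) = 0.
  rewrite mulr_sumr scalar_re_sum; move/rowP/(_ (rshift d i)): zeroE.
  rewrite mxE summxE => {2}->; apply: eq_bigr => j _.
  by rewrite -mulrA mulrCA scalar_reZ !mxE (unsplitK (inr i)).
by rewrite re0 im0 scalar_of_real0 mulr0 subr0.
Qed.

End Orthogonality.

Theorem corollary3p6 (R : realType) (k : scalar_kind)
  (X : completeNormedModType (scalar_field R k))
  (X_neq0 : exists x : X, x != 0)
  (w_norm : num_radius_is_norm X)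
  (X_fin : finite_dim X)
  (d : nat) (d_ge1 : (1 <= d)%N)
  (p : R) (p_gt1 : 1 < p)
  (T S : 'I_d -> X -> X)
  (T_bl : forall i, bounded_linear (T i))
  (S_bl : forall i, bounded_linear (S i))
  (T_notin : ~ exists lam : 'I_d -> scalar_field R k, T = tuple_scale lam S) :
  (forall lam : 'I_d -> scalar_field R k,
     joint_num_radius p T <= joint_num_radius p (T + tuple_scale lam S))
  <->
  (exists (n : nat) (t : 'I_n -> R) (x : 'I_n -> X)
      (f : 'I_n -> X -> (scalar_field R k)^o),
    [/\ forall j, 0 < t j,
        forall j, extreme_points (@unit_ball R k X) (x j),
        forall j, extreme_points (@dual_ball R k X) (f j),
        \sum_(j < n) t j = 1
      & (forall j, joint_attain p T (x j, f j)) /\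
        forall i : 'I_d,
          \sum_(j < n) scalar_of_real k (t j) * conj_pow p (f j (T i (x j)))
                       * f j (S i (x j)) = 0]).
Proof.
have nonempty := state_pairs_nonempty X_neq0 w_norm.
have Tlin i : linear (T i) by case: (T_bl i).
have Slin i : linear (S i) by case: (S_bl i).
split=> [min_w|[n [t [x [f [t_gt0 _ _ t1 [att bal]]]]]]].
  exact: (balance_of_radius_ge X_fin nonempty p_gt1 Tlin Slin min_w).
exact: (radius_ge_of_balance X_fin nonempty p_gt1 Tlin Slin t_gt0 t1 att bal).
Qed.
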